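(* For $0<|q|<1$ we have $$\sum_{n\ge1}\frac{(-1)^n(1+q^n)q^{\frac{n(n+1)}{2}}\bigl(1-q^{n^2}\bigr)}{(1-q^n)^2}=-\frac{q}{(q)_\infty^2}\Bigl(\sum_{n,m\ge0}-\sum_{n,m<0}\Bigr)(-1)^n(n+1)^2q^{\frac{n^2+3n}{2}+3nm+3m^2+4m}.$$
   Context: Notation: $(q)_\infty=\prod_{j\ge1}(1-q^j)$; the sums on the right run over pairs of integers $(n,m)$ with both $n,m\ge0$, respectively both $n,m<0$. *)

(* Defs.v *)
From HB Require Import structures.
From mathcomp Require Import all_boot all_order all_algebra finmap complex.
From mathcomp Require Import boolp classical_sets reals topology normedtype sequences.
From mathcomp.analysis.showcase Require Import summability.

Set Implicit Arguments.
Unset Strict Implicit.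
Unset Printing Implicit Defensive.

Import Order.TTheory GRing.Theory Num.Theory numFieldNormedType.Exports.

Local Open Scope classical_set_scope.
Local Open Scope ring_scope.
Local Open Scope complex_scope.

(* The library puts the norm topology on every abstract numFieldType, but not on
   the concrete type R[i]; the copy below is that same topology (the one of the
   complex modulus). *)
HB.instance Definition _ (R : realType) := NormedModule.copy R[i] R[i]^o.

Definition lhs_term (K : numFieldType) (q : K) (n : nat) : K :=
  (-1) ^+ n * (1 + q ^+ n) * q ^+ (n * n.+1)./2 * (1 - q ^+ (n ^ 2)%N)
  / (1 - q ^+ n) ^+ 2.

Definition qpoch_part (K : numFieldType) (q : K) (N : nat) : K :=
  \prod_(1 <= j < N.+1) (1 - q ^+ j).

Definition qpoch (K : numFieldType) (q : K) : K := limn (qpoch_part q).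

(* The division by 2 is exact: n^2 + 3n is even for every integer n. *)
Definition hecke_exp (n m : int) : int :=
  ((n ^+ 2 + 3 * n) %/ 2)%Z + 3 * n * m + 3 * m ^+ 2 + 4 * m.

Definition hecke_term (K : numFieldType) (q : K) (p : int * int) : K :=
  (-1) ^ p.1 * ((p.1 + 1) ^+ 2)%:~R * q ^ hecke_exp p.1 p.2.

Definition nonneg_pair (p : int * int) : bool := (0 <= p.1) && (0 <= p.2).

Definition neg_pair (p : int * int) : bool := (p.1 < 0) && (p.2 < 0).

(* f extended by 0 outside P, so that [sum (on_pairs P f)] is the unordered sum
   of f over P: the limit of its finite partial sums along [totally]. *)
Definition on_pairs (K : numFieldType) (P : pred (int * int))
    (f : int * int -> K) (p : int * int) : K :=
  if P p then f p else 0.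

(* Main.v *)
Require Import Defs.
From mathcomp Require Import all_boot all_order all_algebra finmap complex.
From mathcomp Require Import boolp classical_sets reals topology normedtype sequences.
From mathcomp.analysis.showcase Require Import summability.
From mathcomp Require Import ring zify.

(** Write [Q] for the product of the [1 - q ^ j], [tri n = n (n - 1) / 2], and
    consider, for [c = 0] and [c = 1], the sum over all integers [n] and all
    integers [k, j >= 1] of

      k^2 (-1)^(n + k + j) q^(c n^2 + n (n + 1) / 2 - n j + tri (k + j)).

    Let [theta(z)] be the sum of the [(-1)^k q^(tri k) z^k].  Up to sign, the sum over
    [j] is the coefficient of [z^k] in [theta(z) / (1 - z q^n)] times a factor that
    depends on [n] alone.  So the triple sums are, up to constants, values at [z = 1] of
    [(z d/dz)^2] applied to [theta(z)] times the Appell sums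
    [sum_n (-1)^n q^(c n^2 + n (n + 1) / 2) / (1 - z q^n)], which belong to the cranks
    ([c = 0]) and the ranks ([c = 1]) of partitions.  Both families are absolutely
    summable, and the theorem compares two evaluations of [V], the sum for [c = 1]
    minus the sum for [c = 0].

    Summing over [n] first.  For [c = 0] the sum over [n] vanishes, since a
    reflection of [n] changes the sign of every term ([theta_has_sum]).  For
    [c = 1] the exponent in [n] is pentagonal; moving [n] by [m] changes [j] by
    [3 m], so only the residue of [j] modulo 3 matters: one class gives [0] by
    antisymmetry, and the other two give [Q] by Euler's pentagonal number theorem,
    up to a sign and a power of [q] ([pent_has_sum] with [pent0_has_sum],
    [pent1_has_sum] and [pent2_has_sum]).
    These two classes are the two cones of the Hecke-type double sum, so
    [V = q Q (S1 - S2)], where [S1] and [S2] are the sums over the nonnegative and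
    the negative pairs ([appell_sum_hecke]).

    Summing over [k] and [j] first.  The terms with [n = 0] cancel between the two
    values of [c].  Those for [n] and [- n] combine, and after grouping by [k + j]
    the inner sums are finite and have a closed form ([sum_sqr_geo_sym]); what
    remains are Jacobi's series for [Q ^ 3] and a theta series that vanishes.  The
    result is [V = - Q ^ 3] times the left-hand side ([lhs_cvg]).

    Dividing by [- Q ^ 3] gives the theorem.  Euler's and Jacobi's identities are
    obtained as limits of finite identities, by dominated convergence
    ([has_sum_tannery]).  The argument works over any numeric field in which
    absolutely summable families are summable ([hecke_identity]); the complex
    numbers are such a field ([abs_complete_complex]). *)

Set Implicit Arguments.
Unset Strict Implicit.
Unset Printing Implicit Defensive.

Import Order.TTheory GRing.Theory Num.Theory numFieldNormedType.Exports.

Local Open Scope classical_set_scope.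
Local Open Scope ring_scope.
Local Open Scope complex_scope.

#[local] Existing Instance totally_filter.

(** * Unordered sums *)

Lemma fset_preimage (I J : choiceType) (h : J -> I) (B : {fset I}) :
  injective h -> exists B' : {fset J}, forall j, (j \in B') = (h j \in B).
Proof.
move=> hI; elim/fset1U_rect: B => [|x B _ [B' hB']].
  by exists fset0 => j; rewrite !in_fset0.
have [[j hj]|nj] := pselect (exists j, h j = x).
  exists (j |` B')%fset => i; rewrite !in_fset1U hB' -hj.
  by rewrite (inj_eq hI).
exists B' => i; rewrite in_fset1U hB'; case: eqP => // hi.
by case: nj; exists i.
Qed.

Lemma bounded_fset (A : {fset nat}) : exists n, forall i, i \in A -> (i < n)%N.
Proof.
elim/fset1U_rect: A => [|x A _ [n IH]]; first by exists 0%N.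
exists (maxn x.+1 n) => i; rewrite in_fset1U => /orP[/eqP ->|/IH lin].
  exact: leq_maxl.
exact: leq_trans (leq_maxr _ _).
Qed.

Section HasSum.
Variable K : numFieldType.

Definition has_sum (I : choiceType) (f : I -> K) (l : K) : Prop :=
  partial_sum f @ totally --> l.

Lemma has_sumP (I : choiceType) (f : I -> K) (l : K) :
  has_sum f l <-> forall e, 0 < e -> exists A : {fset I},
    forall B : {fset I}, (A `<=` B)%fset -> `|l - \sum_(i <- B) f i| < e.
Proof.
split=> [h e e0|h].
  have [A _ hA] := cvgr_dist_lt _ _ h _ e0.
  by exists A => B /hA; rewrite /= /partial_sum big_seq_fsetE.
apply/cvgrPdist_lt => e /h [A hA]; exists A => // B /hA.
by rewrite /= /partial_sum big_seq_fsetE.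
Qed.

Lemma has_sum_unique (I : choiceType) (f : I -> K) (l l' : K) :
  has_sum f l -> has_sum f l' -> l = l'.
Proof. by apply: cvg_unique; apply: norm_hausdorff. Qed.

Lemma eq_has_sum (I : choiceType) (f g : I -> K) (l : K) :
  f =1 g -> has_sum f l -> has_sum g l.
Proof. by move=> /funext ->. Qed.

Lemma has_sumD (I : choiceType) (f g : I -> K) (l m : K) :
  has_sum f l -> has_sum g m -> has_sum (fun i => f i + g i) (l + m).
Proof.
move=> hf hg; rewrite /has_sum.
have -> : partial_sum (fun i => f i + g i) = partial_sum f \+ partial_sum g.
  by apply/funext => A; rewrite /partial_sum /= big_split.
exact: cvgD.
Qed.

Lemma has_sumZ (I : choiceType) (c : K) (f : I -> K) (l : K) :
  has_sum f l -> has_sum (fun i => c * f i) (c * l).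
Proof.
move=> hf; rewrite /has_sum.
have -> : partial_sum (fun i => c * f i) = fun A => c * partial_sum f A.
  by apply/funext => A; rewrite /partial_sum mulr_sumr.
by apply: cvgM => //; exact: cvg_cst.
Qed.

Lemma has_sumN (I : choiceType) (f : I -> K) (l : K) :
  has_sum f l -> has_sum (fun i => - f i) (- l).
Proof.
move=> /(@has_sumZ _ (-1)); rewrite mulN1r.
by apply: eq_has_sum => i; rewrite mulN1r.
Qed.

Lemma sum_fset_extend (I J : choiceType) (h : J -> I) (f : I -> K)
    (A : {fset I}) (B : {fset J}) :
  injective h -> (forall j, j \in B -> h j \in A) ->
  (forall i, i \in A -> (forall j, j \in B -> h j != i) -> f i = 0) ->
  \sum_(i <- A) f i = \sum_(j <- B) f (h j).
Proof.
move=> hI hBA h0.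
have -> : \sum_(j <- B) f (h j) = \sum_(i <- (h @` B)%fset) f i.
  by rewrite big_imfset //= => x y _ _; apply: hI.
symmetry; apply: big_fset_incl.
  by apply/fsubsetP => i /imfsetP[j jB ->]; apply: hBA.
move=> i iA iN; apply: h0 => // j jB; apply/eqP => hj.
by move/negP: iN; apply; apply/imfsetP; exists j.
Qed.

(** Together with [has_sum_restrict], this is both reindexing along a bijection and
    extension of a family by zero. *)
Lemma has_sum_extend (I J : choiceType) (h : J -> I) (f : I -> K) (l : K) :
  injective h -> (forall i, (forall j, h j != i) -> f i = 0) ->
  has_sum (f \o h) l -> has_sum f l.
Proof.
move=> hI h0 /has_sumP hs; apply/has_sumP => e /hs[A hA].
exists (h @` A)%fset => B AB.
have [B' hB'] := fset_preimage B hI.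
rewrite (@sum_fset_extend _ _ h f B B') //.
- apply: hA; apply/fsubsetP => j jA; rewrite hB'.
  by apply: (fsubsetP AB); apply/imfsetP; exists j.
- by move=> j; rewrite hB'.
- move=> i iB hi; apply: h0 => j; apply/eqP => hj.
  by move: (hi j); rewrite hB' hj iB eqxx => /(_ isT).
Qed.

Lemma has_sum_restrict (I J : choiceType) (h : J -> I) (f : I -> K) (l : K) :
  injective h -> (forall i, (forall j, h j != i) -> f i = 0) ->
  has_sum f l -> has_sum (f \o h) l.
Proof.
move=> hI h0 /has_sumP hs; apply/has_sumP => e /hs[A hA].
have [A' hA'] := fset_preimage A hI.
exists A' => B AB.
have := hA (A `|` h @` B)%fset (fsubsetUl _ _).
rewrite (@sum_fset_extend _ _ h f _ B) //.
  by move=> j jB; rewrite in_fsetU; apply/orP; right; apply/imfsetP; exists j.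
move=> i; rewrite in_fsetU => /orP[iA|/imfsetP[j jB ->]] hi; last first.
  by move: (hi j jB); rewrite eqxx.
apply: h0 => j; apply/eqP => hj.
have : j \in B by apply: (fsubsetP AB); rewrite hA' hj.
by move/hi; rewrite hj eqxx.
Qed.

(** The source of all the vanishing theta series below. *)
Lemma has_sum_antisym (I : choiceType) (s : I -> I) (f : I -> K) (l : K) :
  involutive s -> (forall i, f (s i) = - f i) -> has_sum f l -> l = 0.
Proof.
move=> sK fs hl.
have hl' : has_sum (fun i => - f i) l.
  have -> : (fun i => - f i) = f \o s by apply/funext => i /=; rewrite fs.
  apply: has_sum_restrict => //; first exact: inv_inj.
  by move=> i /(_ (s i)); rewrite sK eqxx.
have /eqP := has_sum_unique hl' (has_sumN hl).
by rewrite -addr_eq0 -mulr2n mulrn_eq0 => /= /eqP.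
Qed.

(** An unordered sum may be computed along any exhausting sequence of finite sets;
    this turns unordered sums into ordinary limits of partial sums. *)
Lemma has_sum_exhaust (I : choiceType) (f : I -> K) (l : K)
    (A : nat -> seq I) :
  (forall n, uniq (A n)) -> (forall i, \forall n \near \oo, i \in A n) ->
  has_sum f l -> (fun n => \sum_(i <- A n) f i) @ \oo --> l.
Proof.
move=> uA hA hs.
have -> : (fun n => \sum_(i <- A n) f i) =
    partial_sum f \o (fun n => seq_fset tt (A n)).
  apply/funext => n; transitivity (\sum_(i <- seq_fset tt (A n)) f i).
    by rewrite (perm_big _ (seq_fset_perm tt (A n))) undup_id.
  by rewrite big_seq_fsetE.
apply: cvg_comp hs => P [B _ hB]; rewrite /nbhs /=.
suff : \forall n \near \oo, (B `<=` seq_fset tt (A n))%fset.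
  by apply: filterS => n; apply: hB.
elim/fset1U_rect: B {hB} => [|x B _ IH].
  by apply: nearW => n; rewrite fsub0set.
near=> n; rewrite fsubUset fsub1set seq_fsetE; apply/andP; split; near: n => //.
Unshelve. all: end_near.
Qed.

Lemma has_sum_series (f : nat -> K) (l : K) :
  has_sum f l -> (fun n => \sum_(i < n) f i) @ \oo --> l.
Proof.
move=> hs.
have -> : (fun n => \sum_(i < n) f i) = fun n => \sum_(i <- iota 0 n) f i.
  by apply/funext => n; rewrite -(big_mkord xpredT) /index_iota subn0.
apply: has_sum_exhaust hs => [n|i]; first exact: iota_uniq.
by near=> n; rewrite mem_iota /= add0n; near: n; exact: nbhs_infty_gt.
Unshelve. all: end_near.
Qed.

(** Fubini's theorem for unordered sums: a finite
    partial sum of [G] is approximated by the sum of [F] over a box, and the box can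
    be taken large enough to approximate [l] as well. *)
Lemma has_sum_prod (I J : choiceType) (F : I * J -> K) (G : I -> K) (l : K) :
  (forall i, has_sum (fun j => F (i, j)) (G i)) -> has_sum F l -> has_sum G l.
Proof.
move=> hG /has_sumP hF; apply/has_sumP => e e0.
have e20 : 0 < e / 2 by rewrite divr_gt0.
have [A hA] := hF _ e20.
exists (fst @` A)%fset => B AB.
have hB : (fun C : {fset J} => \sum_(i <- B) partial_sum (fun j => F (i, j)) C)
    @ totally --> \sum_(i <- B) G i.
  elim: (enum_fset B) => [|i s IH].
    by under eq_fun do rewrite big_nil; rewrite big_nil; apply: cvg_cst.
  under eq_fun do rewrite big_cons; rewrite big_cons.
  by apply: cvgD => //; apply: hG.
have /cvgrPdist_lt/(_ _ e20) [C _ hC] := hB.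
set C' := (C `|` snd @` A)%fset.
have {}hC := hC C' (fsubsetUl _ _).
have := hA [fset ((i, j) : I * J) | i in B, j in C']%fset.
rewrite big_imfset2 /=; last by move=> [??] [??] _ _ /= [-> ->].
have -> : (A `<=` [fset ((i, j) : I * J) | i in B, j in C'])%fset.
  apply/fsubsetP => -[i j] ijA; apply/imfset2P.
  exists i; first by apply: (fsubsetP AB); apply/imfsetP; exists (i, j).
  exists j => //; rewrite in_fsetU; apply/orP; right.
  by apply/imfsetP; exists (i, j).
move=> /(_ isT) h1.
have hCE i : partial_sum (fun j => F (i, j)) C' = \sum_(j <- C') F (i, j).
  by rewrite big_seq_fsetE.
move: hC => /=; rewrite (eq_bigr _ (fun i _ => hCE i)).
rewrite -(subrK (\sum_(i <- B) \sum_(j <- C') F (i, j)) l) -addrA => h2.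
apply: le_lt_trans (ler_normD _ _) _; rewrite [e]splitr ltrD //.
by rewrite distrC.
Qed.

(** Cauchy's criterion. *)
Lemma has_sum_tail (I : choiceType) (f : I -> K) (l e : K) :
  has_sum f l -> 0 < e -> exists A : {fset I}, forall B : {fset I},
    (forall i, i \in B -> i \notin A) -> `|\sum_(i <- B) f i| < e.
Proof.
move=> /has_sumP hf e0; have e20 : 0 < e / 2 by rewrite divr_gt0.
have [A hA] := hf _ e20; exists A => B AB.
have h1 := hA A (fsubset_refl _); have := hA (A `|` B)%fset (fsubsetUl _ _).
have -> : \sum_(i <- (A `|` B)%fset) f i = \sum_(i <- A) f i + \sum_(i <- B) f i.
  rewrite -big_cat; apply: perm_big; apply: uniq_perm => [||i].
  - exact: fset_uniq.
  - rewrite cat_uniq !fset_uniq /= andbT; apply/hasPn => i /AB.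
    by [].
  by rewrite in_fsetU mem_cat.
move=> h2; rewrite [e]splitr.
have -> : \sum_(i <- B) f i = (l - \sum_(i <- A) f i) -
    (l - (\sum_(i <- A) f i + \sum_(i <- B) f i)).
  by ring.
by apply: le_lt_trans (ler_normB _ _) _; rewrite ltrD.
Qed.

Lemma has_sum_cvg0 (I : choiceType) (h : nat -> I) (f : I -> K) (l : K) :
  injective h -> has_sum f l -> (fun n => f (h n)) @ \oo --> (0 : K).
Proof.
move=> hI hl; apply/cvgrPdist_lt => e e0.
have [A hA] := has_sum_tail hl e0; have [A' hA'] := fset_preimage A hI.
have [N hN] := bounded_fset A'.
exists N => // n /= Nn; rewrite sub0r normrN.
have := hA [fset h n]%fset; rewrite big_seq_fset1; apply=> i.
rewrite in_fset1 => /eqP ->; apply: contraL Nn.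
by rewrite -hA' => /hN; rewrite -ltnNge.
Qed.

Lemma has_sum_single (f : nat -> K) : (forall k, f k.+1 = 0) -> has_sum f (f 0%N).
Proof.
move=> f0; apply/has_sumP => e e0; exists [fset 0%N]%fset => B hB.
rewrite -(big_fset_incl _ hB); first by rewrite big_seq_fset1 subrr normr0.
by case=> [|n] _; rewrite in_fset1.
Qed.

(** Summation over the integers along the intervals [1 - M .. M], which are symmetric
    under [n |-> 1 - n], the symmetry of [n (n - 1) / 2]. *)
Lemma has_sum_int_paired (f : int -> K) (l : K) : has_sum f l ->
  (fun M => \sum_(s < M) (f s.+1%:Z + f (- s%:Z))) @ \oo --> l.
Proof.
move=> hl.
pose A M : seq int := map (fun s => s.+1%:Z) (iota 0 M) ++ map (fun s => - s%:Z) (iota 0 M).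
have -> : (fun M => \sum_(s < M) (f s.+1%:Z + f (- s%:Z))) = fun M => \sum_(i <- A M) f i.
  apply/funext => M; rewrite big_cat !big_map big_split /=.
  rewrite -(big_mkord xpredT (fun s => f s.+1%:Z)).
  by rewrite -(big_mkord xpredT (fun s => f (- s%:Z))) /index_iota subn0.
apply: has_sum_exhaust hl => [M|i].
  rewrite cat_uniq !map_inj_uniq ?iota_uniq /= ?andbT; [|by move=> x y; lia..].
  by apply/hasPn => x /mapP[s _ ->]; apply/mapP => -[t _]; lia.
exists `|i|.+1 => // M /= hM; rewrite mem_cat.
have [i0|i0] := ltrP 0 i; apply/orP; [left|right]; apply/mapP.
  by exists `|i|.-1; [rewrite mem_iota; lia|lia].
by exists `|i|%N; [rewrite mem_iota; lia|lia].
Qed.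

Lemma has_sum_int_sym (f : int -> K) (l : K) : has_sum f l ->
  (fun M => f 0 + \sum_(s < M) (f s.+1%:Z + f (- s.+1%:Z))) @ \oo --> l.
Proof.
move=> hl.
have h0 : (fun M : nat => f (- M%:Z)) @ \oo --> (0 : K).
  by apply: has_sum_cvg0 hl => m n; lia.
have h := has_sum_int_paired hl.
have -> : (fun M => f 0 + \sum_(s < M) (f s.+1%:Z + f (- s.+1%:Z))) =
    fun M => \sum_(s < M) (f s.+1%:Z + f (- s%:Z)) + f (- M%:Z).
  apply/funext; elim=> [|M IH]; first by rewrite !big_ord0 oppr0; ring.
  by rewrite !big_ord_recr /= addrA IH; ring.
by rewrite -[l]addr0; apply: cvgD.
Qed.

End HasSum.

(** * Absolute summability and dominated convergence *)

Section AbsSummable.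
Variable K : numFieldType.
Implicit Types I J : choiceType.

Definition abs_summable I (f : I -> K) : Prop :=
  exists M, forall A : {fset I}, \sum_(i <- A) `|f i| <= M.

(** The form of completeness on which all existence of sums rests; it passes
    from the real to the complex numbers componentwise. *)
Definition abs_complete : Prop := forall I (f : I -> K),
  abs_summable f -> exists l, has_sum f l.

Lemma ler_sum_subset (T : eqType) (s t : seq T) (F : T -> K) :
  uniq s -> uniq t -> {subset s <= t} -> (forall i, 0 <= F i) ->
  \sum_(i <- s) F i <= \sum_(i <- t) F i.
Proof.
move=> us ut st F0.
have -> : \sum_(i <- s) F i = \sum_(i <- t | i \in s) F i.
  rewrite -[RHS]big_filter; apply: perm_big; apply: uniq_perm => [//||i].
    exact: filter_uniq.
  by rewrite mem_filter; case: (boolP (i \in s)) => // /st ->.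
by rewrite [leRHS](bigID (fun i => i \in s)) /= lerDl sumr_ge0.
Qed.

Lemma abs_summable_le I (f g : I -> K) :
  (forall i, `|f i| <= `|g i|) -> abs_summable g -> abs_summable f.
Proof.
move=> fg [M hM]; exists M => A; apply: le_trans (hM A).
by apply: ler_sum => i _; apply: fg.
Qed.

Lemma abs_summableD I (f g : I -> K) :
  abs_summable f -> abs_summable g -> abs_summable (fun i => f i + g i).
Proof.
move=> [M hM] [N hN]; exists (M + N) => A.
apply: (le_trans _ (lerD (hM A) (hN A))); rewrite -big_split /=.
by apply: ler_sum => i _; apply: ler_normD.
Qed.

Lemma abs_summableZ I (c : K) (f : I -> K) :
  abs_summable f -> abs_summable (fun i => c * f i).
Proof.
move=> [M hM]; exists (`|c| * M) => A.
under eq_bigr do rewrite normrM.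
by rewrite -mulr_sumr ler_wpM2l.
Qed.

Lemma abs_summable_comp I J (h : J -> I) (f : I -> K) :
  injective h -> abs_summable f -> abs_summable (f \o h).
Proof.
move=> hI [M hM]; exists M => A.
have := hM (h @` A)%fset; rewrite big_imfset //= => x y _ _; exact: hI.
Qed.

Lemma abs_summable_nat (f : nat -> K) (M : K) :
  (forall n, \sum_(i < n) `|f i| <= M) -> abs_summable f.
Proof.
move=> hM; exists M => A.
have [n hn] := bounded_fset A.
apply: le_trans (hM n); rewrite -(big_mkord xpredT (fun i => `|f i|)).
apply: ler_sum_subset => [||i|//]; [exact: fset_uniq|exact: iota_uniq|].
by rewrite mem_index_iota; exact: hn.
Qed.

Lemma abs_summable_prod I J (f : I -> K) (g : J -> K) :
  abs_summable f -> abs_summable g ->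
  abs_summable (fun p : I * J => f p.1 * g p.2).
Proof.
move=> [M hM] [N hN]; exists (M * N) => A.
set B := [fset ((i, j) : I * J) | i in (fst @` A)%fset, j in (snd @` A)%fset]%fset.
have AB : (A `<=` B)%fset.
  apply/fsubsetP => -[i j] ijA; apply/imfset2P.
  exists i; first by apply/imfsetP; exists (i, j).
  by exists j => //; apply/imfsetP; exists (i, j).
apply: (@le_trans _ _ (\sum_(p <- B) `|f p.1 * g p.2|)).
  by apply: ler_sum_subset; [exact: fset_uniq..|exact: (fsubsetP AB)|].
rewrite /B big_imfset2 /=; last by move=> [??] [??] _ _ /= [-> ->].
under eq_bigr do [under eq_bigr do rewrite normrM; rewrite -mulr_sumr].
rewrite -mulr_suml; apply: ler_pM => //; apply: sumr_ge0 => // *.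
Qed.

Lemma abs_summable_fin (T : finType) (f : T -> K) : abs_summable f.
Proof.
exists (\sum_i `|f i|) => A.
apply: ler_sum_subset => [||i _|//]; last exact: mem_index_enum.
  exact: fset_uniq.
exact: index_enum_uniq.
Qed.

Lemma abs_summable_absz (f : nat -> K) :
  abs_summable f -> abs_summable (fun n : int => f `|n|%N).
Proof.
move=> fs; have h : injective (fun n : int => (0 <= n, `|n|%N)).
  by move=> m n /= []; lia.
have := abs_summable_comp h (abs_summable_prod (@abs_summable_fin _ (fun=> 1)) fs).
by apply: abs_summable_le => n /=; rewrite mul1r.
Qed.

Lemma abs_summable_geo (r : K) : `|r| < 1 -> abs_summable (fun n : nat => r ^+ n).
Proof.
move=> r1; apply: (@abs_summable_nat _ (1 - `|r|)^-1) => n.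
rewrite -[leRHS]mul1r ler_pdivlMr ?subr_gt0 //.
under eq_bigr do rewrite normrX.
have -> : (\sum_(i < n) `|r| ^+ i) * (1 - `|r|) = 1 - `|r| ^+ n.
  by rewrite -(opprB (`|r| ^+ _)) subrX1; ring.
by rewrite gerBl exprn_ge0.
Qed.

(** A factor [n + 1] costs only a slightly larger ratio: with [r' = (1 + r) / 2] and
    [t = r / r'], the number [(n + 1) t^n] is at most [1 + t + ... + t^n], which is
    bounded. *)
Lemma natmul_geo (r : K) : 0 <= r -> r < 1 -> exists C r',
  [/\ 0 <= C, 0 <= r', r' < 1 & forall n, n.+1%:R * r ^+ n <= C * r' ^+ n].
Proof.
move=> r0 r1; pose r' := (1 + r) / 2; pose t := r / r'.
have r'0 : 0 < r' by rewrite divr_gt0 // ltr_pwDl.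
have r'1 : r' < 1 by rewrite ltr_pdivrMr // mul1r (_ : 2 = 1 + 1) // ltrD2l.
have t0 : 0 <= t by rewrite divr_ge0 // ltW.
have t1 : t < 1 by rewrite ltr_pdivrMr // mul1r ltr_pdivlMr // mulrDr mulr1 ltrD2r.
exists (1 - t)^-1, r'; split => //; [by rewrite invr_ge0 subr_ge0 ltW|exact: ltW|].
move=> n; have -> : r = t * r' by rewrite divfK // gt_eqF.
rewrite exprMn mulrA ler_wpM2r ?exprn_ge0 ?(ltW r'0) //.
rewrite -[leRHS]mul1r ler_pdivlMr ?subr_gt0 //.
apply: (@le_trans _ _ ((\sum_(i < n.+1) t ^+ i) * (1 - t))).
  rewrite ler_wpM2r ?subr_ge0 ?(ltW t1) //.
  rewrite -[n.+1 in leLHS]card_ord -sumr_const mulr_suml; apply: ler_sum => i _.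
  by rewrite mul1r ler_wiXn2l // ?ltW // -ltnS.
have -> : (\sum_(i < n.+1) t ^+ i) * (1 - t) = 1 - t ^+ n.+1.
  by rewrite -(opprB (t ^+ _)) subrX1; ring.
by rewrite gerBl exprn_ge0.
Qed.

(** Tannery's theorem, that is, dominated convergence for series. *)
Lemma has_sum_tannery (f_ : nat -> nat -> K) (f g : nat -> K) (l : K) :
  abs_complete -> abs_summable g -> (forall n k, `|f_ n k| <= `|g k|) ->
  (forall k, (fun n => f_ n k) @ \oo --> f k) -> has_sum f l ->
  (fun n => \sum_(k < n.+1) f_ n k) @ \oo --> l.
Proof.
move=> cK gs f_g f_f hl; apply/cvgrPdist_lt => e e0.
have e30 : 0 < e / 3 by rewrite divr_gt0.
have [L hL] : exists L, has_sum (fun k => `|g k|) L.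
  by apply: cK; apply: abs_summable_le gs => k; rewrite normr_id.
have [A hA] := has_sum_tail hL e30.
(* Beyond [N0] the sums of [g], hence of every [f_ n], are small; beyond [N1] the
   partial sums of [f] are close to [l]. *)
have [N0 hN0] := bounded_fset A.
have [N1 _ hN1] := cvgr_dist_lt _ _ (has_sum_series hl) _ e30.
set N := maxn N0 N1.
have tail n : `|\sum_(N <= k < n.+1) f_ n k| < e / 3.
  apply: le_lt_trans (ler_norm_sum _ _ _) _.
  apply: (@le_lt_trans _ _ (\sum_(k <- seq_fset tt (index_iota N n.+1)) `|g k|)).
    rewrite (perm_big _ (seq_fset_perm tt _)) undup_id ?iota_uniq //.
    by apply: ler_sum => k _; apply: f_g.
  rewrite -[ltLHS]ger0_norm ?sumr_ge0 //; apply: hA => i.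
  rewrite seq_fsetE mem_index_iota => /andP[Ni _].
  apply: contraL Ni => /hN0 iN; rewrite -ltnNge.
  exact: leq_trans iN (leq_maxl _ _).
have head m : (fun n => \sum_(k < m) f_ n k) @ \oo --> \sum_(k < m) f k.
  elim: m => [|m IH].
    by under eq_fun do rewrite big_ord0; rewrite big_ord0; apply: cvg_cst.
  by under eq_fun do rewrite big_ord_recr; rewrite big_ord_recr; apply: cvgD.
have {}head := cvgr_dist_lt _ _ (head N) _ e30.
near=> n.
rewrite -(big_mkord xpredT (f_ n)) (@big_cat_nat _ _ _ N) //=; last first.
  by near: n; exists N => // n /= Nn; apply: leqW.
rewrite big_mkord.
have -> : l - (\sum_(k < N) f_ n k + \sum_(N <= k < n.+1) f_ n k) =
   (l - \sum_(k < N) f k) + (\sum_(k < N) f k - \sum_(k < N) f_ n k)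
   - \sum_(N <= k < n.+1) f_ n k by ring.
have -> : e = e / 3 + e / 3 + e / 3.
  by field.
apply: le_lt_trans (ler_normB _ _) _; rewrite ltrD //; last first.
apply: le_lt_trans (ler_normD _ _) _; rewrite ltrD //.
  by apply: hN1; rewrite /= leq_maxr.
by near: n; exact: head.
Unshelve. all: end_near.
Qed.

End AbsSummable.

(** * Completeness of the complex numbers *)

(** A nonnegative family with bounded partial sums has their supremum as its sum, and
    [f = |f| - (|f| - f)] is a difference of two such families. *)
Lemma abs_complete_real (R : realType) : abs_complete R.
Proof.
move=> I f [M hM].
have pos (v : I -> R) : (forall i, 0 <= v i) ->
    (exists M, forall A : {fset I}, \sum_(i <- A) v i <= M) ->
    exists l, has_sum v l.
  move=> v0 [N hN]; pose S := [set x | exists A : {fset I}, x = \sum_(i <- A) v i].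
  have hS : has_sup S.
    split; first by exists (\sum_(i <- fset0) v i); exists fset0.
    by exists N => _ [A ->].
  exists (sup S); apply/has_sumP => e e0.
  have [_ [A ->] hA] := sup_adherent e0 hS; exists A => B AB.
  have hB : \sum_(i <- B) v i <= sup S by apply: ub_le_sup; [case: hS|exists B].
  rewrite ger0_norm ?subr_ge0 // ltrBlDr addrC -ltrBlDr; apply: lt_le_trans hA _.
  by apply: ler_sum_subset; [exact: fset_uniq..|exact: (fsubsetP AB)|].
have [a ha] : exists a, has_sum (fun i => `|f i|) a.
  by apply: pos => //; exists M.
have [b hb] : exists b, has_sum (fun i => `|f i| - f i) b.
  apply: pos => [i|]; first by rewrite subr_ge0 ler_norm.
  exists (M + M) => A; apply: le_trans (lerD (hM A) (hM A)).
  rewrite -big_split /=; apply: ler_sum => i _; rewrite lerD2l.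
  by rewrite -normrN ler_norm.
exists (a - b); have := has_sumD ha (has_sumN hb).
by apply: eq_has_sum => i; rewrite opprB addrC subrK.
Qed.

Lemma normC_real (R : realType) (x : R) : `|x%:C| = `|x|%:C.
Proof. by rewrite normc_def /= expr0n /= addr0 sqrtr_sqr. Qed.

Lemma abs_complete_complex (R : realType) : abs_complete R[i].
Proof.
move=> I f [M hM].
have real (u : I -> R) : (forall i, `|u i|%:C <= `|f i|) ->
    exists a, has_sum (fun i => (u i)%:C) a.
  move=> uf; have [|a /has_sumP ha] := @abs_complete_real R I u.
    exists (complex.Re M) => A.
    have : (\sum_(i <- A) `|u i|)%:C <= M.
      rewrite rmorph_sum /=; apply: le_trans (hM A).
      by apply: ler_sum => i _; apply: uf.
    by rewrite lecE => /andP[].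
  exists a%:C; apply/has_sumP => e e0.
  have eR : (complex.Re e)%:C = e by rewrite RRe_real // gtr0_real.
  have /ha[A hA] : 0 < complex.Re e by rewrite -ltcR eR.
  exists A => B /hA; rewrite -(ltcR _ (complex.Re e)) eR -normC_real.
  by rewrite rmorphB rmorph_sum.
have [a ha] := real (fun i => complex.Re (f i)) (fun i => normc_ge_Re _).
have [|b hb] := real (fun i => complex.Im (f i)).
  move=> i; have := normc_ge_Re (f i * 'i%C); rewrite ReiNIm normrN normrM.
  suff -> : `|('i%C : R[i])| = 1 by rewrite mulr1.
  by rewrite normc_def /= expr0n /= expr1n add0r sqrtr1.
exists (a + 'i%C * b); apply: eq_has_sum (has_sumD ha (has_sumZ (c := 'i%C) hb)).
by move=> i; rewrite -complexE.
Qed.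

(** * Infinite products *)

Lemma bounded_seq (K : numFieldType) (u : nat -> K) :
  cvgn u -> exists M, forall n, `|u n| <= M.
Proof.
move=> /cvg_seq_bounded [M [_ hM]]; exists (M + 1) => n.
by apply: hM => //=; rewrite ltrDl.
Qed.

Section Product.
Variable K : numFieldType.
Hypothesis cK : abs_complete K.

(** Only the tail matters, and on a tail whose sum is at most [1 / 2] Weierstrass'
    inequality [prod (1 + b_i) (1 - sum b_i) <= 1] bounds the product by [2]. *)
Lemma prod1D_bounded (b : nat -> K) : (forall i, 0 <= b i) ->
  abs_summable b -> exists2 M, 0 <= M & forall n, \prod_(i < n) (1 + b i) <= M.
Proof.
move=> b0 bs; have [l hl] := cK bs.
have half0 : 0 < 2^-1 :> K by rewrite invr_gt0.
have [A hA] := has_sum_tail hl half0; have [N hN] := bounded_fset A.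
have P0 m n : 0 <= \prod_(m <= i < n) (1 + b i).
  by apply: prodr_ge0 => i _; rewrite addr_ge0.
have tail n : \sum_(N <= i < n) b i <= 2^-1.
  rewrite -[leLHS]ger0_norm ?sumr_ge0 //.
  have -> : \sum_(N <= i < n) b i = \sum_(i <- seq_fset tt (index_iota N n)) b i.
    by rewrite (perm_big _ (seq_fset_perm tt _)) undup_id ?iota_uniq.
  apply: ltW; apply: hA => i; rewrite seq_fsetE mem_index_iota => /andP[Ni _].
  by apply: contraL Ni => /hN; rewrite -ltnNge.
have weier n : \prod_(N <= i < n) (1 + b i) * (1 - \sum_(N <= i < n) b i) <= 1.
  have [Nn|nN] := leqP N n; last by rewrite !big_geq 1?ltnW // subr0 mulr1.
  rewrite -(subnKC Nn); elim: (n - N)%N => [|k IH].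
    by rewrite !big_geq ?addn0 // subr0 mulr1.
  rewrite addnS !big_nat_recr ?leq_addr //=; apply: le_trans IH.
  rewrite -mulrA ler_wpM2l ?P0 // -subr_ge0.
  set s := \sum_(N <= i < _) b i; set c := b _.
  have -> : 1 - s - (1 + c) * (1 - (s + c)) = c * s + c * c by ring.
  by rewrite addr_ge0 ?mulr_ge0 // ?b0 // sumr_ge0.
have tailP n : \prod_(N <= i < n) (1 + b i) <= 2.
  rewrite -(@ler_pM2r _ 2^-1) // divff ?pnatr_eq0 //; apply: le_trans (weier n).
  rewrite ler_wpM2l ?P0 // -subr_ge0.
  have -> : 1 - \sum_(N <= i < n) b i - 2^-1 = 2^-1 - \sum_(N <= i < n) b i by field.
  by rewrite subr_ge0 tail.
have P1 m n : 1 <= \prod_(m <= i < n) (1 + b i).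
  rewrite big_seq_cond; elim/big_ind: _ => // [x y x1 y1|i _].
    by rewrite -[1]mulr1 ler_pM.
  by rewrite lerDl.
exists (\prod_(0 <= i < N) (1 + b i) * 2); first by rewrite mulr_ge0 ?P0.
move=> n; rewrite -(big_mkord xpredT (fun i => 1 + b i)).
have [Nn|nN] := leqP N n.
  by rewrite (@big_cat_nat _ _ _ N) //= ler_wpM2l ?P0.
rewrite (@big_cat_nat _ _ _ n 0 N) ?(ltnW nN) //= -mulrA -[leLHS]mulr1.
rewrite ler_wpM2l ?P0 //; apply: (le_trans (P1 n N)).
by rewrite ler_peMr ?P0 // ler1n.
Qed.

(** The increments of the partial products are bounded by multiples of the [a i], so
    the product is a telescoping absolutely convergent series. *)
Lemma prod1D_cvg (a : nat -> K) :
  abs_summable a -> cvgn (fun n => \prod_(i < n) (1 + a i)).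
Proof.
move=> as_; have [||M M0 hM] := @prod1D_bounded (fun i => `|a i|) => //.
  by apply: abs_summable_le as_ => i; rewrite normr_id.
have dM n : `|\prod_(i < n) (1 + a i)| <= M.
  apply: le_trans (hM n); rewrite normr_prod; apply: ler_prod => i _.
  by rewrite normr_ge0 /= (le_trans (ler_normD _ _)) // normr1.
have [|D hD] := cK (f := fun n => \prod_(i < n) (1 + a i) * a n).
  apply: abs_summable_le (abs_summableZ M as_) => n.
  by rewrite !normrM ler_wpM2r // (ger0_norm M0).
apply/cvg_ex; exists (1 + D).
have -> : (fun n => \prod_(i < n) (1 + a i)) =
    (fun n => 1 + \sum_(i < n) (\prod_(j < i) (1 + a j) * a i)).
  apply/funext; elim=> [|n IH]; first by rewrite !big_ord0 addr0.
  by rewrite big_ord_recr [in RHS]big_ord_recr /= addrA -IH; ring.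
by apply: cvgD; [exact: cvg_cst|exact: (has_sum_series hD)].
Qed.

End Product.

(** * Triangular and pentagonal exponents *)

Definition tri (n : int) : int := (n * (n - 1) %/ 2)%Z.

Lemma triE (n : int) : 2 * tri n = n * (n - 1).
Proof.
have [m [->|->]] : exists m, n = 2 * m \/ n = 2 * m + 1 by exists (n %/ 2)%Z; lia.
  by rewrite /tri -[X in (X %/ _)%Z]mulrA mulKz // mulrA.
rewrite /tri; have -> : (2 * m + 1) * (2 * m + 1 - 1) = 2 * (m * (2 * m + 1)) by ring.
by rewrite mulKz.
Qed.

Lemma tri_ge (n : int) : `|n| - 1 <= tri n.
Proof.
have := triE n; have := sqr_ge0 (`|n| - 1); have := sqr_ge0 (`|n| - 2).
nia.
Qed.

Lemma tri_ge0 (n : int) : 0 <= tri n.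
Proof.
have := tri_ge n; have [->|n0] := eqVneq n 0; first by [].
by lia.
Qed.

Lemma triD (m n : int) : tri (m + n) = tri m + tri n + m * n.
Proof. have := triE (m + n); have := triE m; have := triE n; lia. Qed.

Lemma triNS (n : int) : tri (1 - n) = tri n.
Proof. have := triE (1 - n); have := triE n; lia. Qed.

Lemma bin2S n : 'C(n.+1, 2) = (n + 'C(n, 2))%N.
Proof. by rewrite binS bin1 addnC. Qed.

Lemma tri_bin (n : nat) : tri n = 'C(n, 2).
Proof.
elim: n => [|n IH]; first by rewrite bin0n.
by have := triE n.+1; have := triE n; rewrite bin2S; lia.
Qed.

Lemma bin2D_le n : (n <= 'C(n.+1, 2))%N.
Proof. by rewrite bin2S leq_addr. Qed.

(** The generalized pentagonal numbers [n (3 n + 1) / 2], written so that they visibly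
    exceed triangular numbers. *)
Definition pent (n : int) : int := n ^+ 2 + tri (n + 1).

Lemma pent_nat (m : nat) : pent m = (m ^ 2 + 'C(m.+1, 2))%N.
Proof.
rewrite /pent -mulnn; have -> : m%:Z + 1 = m.+1 by lia.
by rewrite tri_bin; lia.
Qed.

Lemma pentN_nat (m : nat) : pent (- m%:Z) = (m ^ 2 + 'C(m, 2))%N.
Proof.
rewrite /pent -mulnn PoszD -tri_bin PoszM -expr2 sqrrN (_ : tri (- m%:Z + 1) = tri m) //.
have := triE (- m%:Z + 1); have := triE m; generalize (tri (- m%:Z + 1)) (tri m); nia.
Qed.

Lemma pentD (m n : int) : pent (m + n) = pent m + pent n + 3 * m * n.
Proof. rewrite /pent; have -> : m + n + 1 = m + (n + 1) by lia.
have := triD m (n + 1); have := triD m 1; have : tri 1 = 0 by []. lia. Qed.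

Lemma pentN (n : int) : pent (- n) = pent n - n.
Proof.
rewrite /pent sqrrN (addrC (- n)) triNS.
by have := triE (n + 1); have := triE n; lia.
Qed.

Lemma pentBS (n : int) : pent (1 - n) - 2 * (1 - n) = pent n - 2 * n.
Proof.
rewrite /pent; have -> : 1 - n + 1 = 1 - (n - 1) by ring.
rewrite triNS; have := triE (n + 1); have := triE (n - 1).
have -> : (1 - n) ^+ 2 = 1 - 2 * n + n ^+ 2 by ring.
lia.
Qed.

(** * Signed integer powers *)

Section Mono.
Variables (K : numFieldType) (q : K).

(** All terms below are of this form, up to a scalar.  Keeping the exponents of the
    sign and of [q] as integers reduces every identity between terms to a parity
    statement and an equality of exponents. *)
Definition mono (s e : int) : K := (-1) ^ s * q ^ e.

Lemma signz_even (m : int) : (-1) ^ (2 * m) = 1 :> K.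
Proof. by rewrite -exprz_exp -[(-1) ^ 2]exprnP sqrrN expr1n exp1rz. Qed.

Lemma mono_even s s' e e' :
  (exists m, s' - s = 2 * m) -> e = e' -> mono s e = mono s' e'.
Proof.
move=> [m hm] ->; rewrite /mono; have -> : s' = s + 2 * m by lia.
by rewrite [in RHS]expfzDr ?oppr_eq0 ?oner_eq0 // signz_even mulr1.
Qed.

Lemma mono_odd s s' e e' :
  (exists m, s' - s = 2 * m + 1) -> e = e' -> mono s e = - mono s' e'.
Proof.
move=> [m hm] ->; rewrite /mono; have -> : s' = s + 2 * m + 1 by lia.
by rewrite [in RHS]expfzDr ?expfzDr ?oppr_eq0 ?oner_eq0 // signz_even expr1z; ring.
Qed.

Lemma norm_mono s e : `|mono s e| = `|q ^ e|.
Proof.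
rewrite /mono normrM; case: s => n; rewrite ?NegzE -?exprnN -?exprnP ?normfV.
  by rewrite normrX normrN1 expr1n mul1r.
by rewrite normrX normrN1 expr1n invr1 mul1r.
Qed.

Lemma mono0 : mono 0 0 = 1. Proof. by rewrite /mono !expr0z mulr1. Qed.

Lemma monoD s e s' e' : q != 0 -> mono (s + s') (e + e') = mono s e * mono s' e'.
Proof. by move=> q0; rewrite /mono !expfzDr ?oppr_eq0 ?oner_eq0 //; ring. Qed.

End Mono.

Section PowerBounds.
Variables (K : numFieldType) (q : K).
Hypotheses (q_gt0 : 0 < `|q|) (q_lt1 : `|q| < 1).

Let q0 : q != 0.
Proof. by rewrite -normr_gt0. Qed.

Lemma norm_expz_le (a b : int) : a <= b -> `|q ^ b| <= `|q ^ a|.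
Proof.
move=> ab; have [n ->] : exists n : nat, b = a + n%:Z by exists `|b - a|%N; lia.
rewrite expfzDr // normrM ler_piMr // -exprnP normrX.
by rewrite exprn_ile1 // ltW.
Qed.

Lemma abs_summable_sqr_geo :
  abs_summable (fun n : nat => n.+1%:R ^+ 2 * q ^+ n).
Proof.
have [C [r [C0 r0 r1 hr]]] := natmul_geo (normr_ge0 q) q_lt1.
have [D [s [D0 s0 s1 hs]]] := natmul_geo r0 r1.
apply: (@abs_summable_le _ _ _ (fun n => (C * D) * s ^+ n)) => [n|].
  rewrite expr2 -mulrA !normrM normrX !normr_nat.
  rewrite (ger0_norm C0) (ger0_norm D0) (ger0_norm (exprn_ge0 _ s0)).
  apply: (@le_trans _ _ (n.+1%:R * (C * r ^+ n))).
    by rewrite ler_wpM2l.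
  by rewrite mulrCA -mulrA ler_wpM2l.
by apply/abs_summableZ/abs_summable_geo; rewrite ger0_norm.
Qed.

Lemma abs_summable_tri : abs_summable (fun n : int => q ^ tri n).
Proof.
have := abs_summableZ q^-1 (abs_summable_absz (abs_summable_geo q_lt1)).
apply: abs_summable_le => n; apply: le_trans (norm_expz_le (tri_ge n)) _.
by rewrite addrC expfzDr // -exprN1 -exprnP.
Qed.

End PowerBounds.

(** * The product of the [1 - q ^ j] *)

Section Pochhammer.
Variables (K : numFieldType) (q : K).
Local Notation poch := (qpoch_part q).

Lemma poch0 : poch 0 = 1.
Proof. by rewrite /qpoch_part big_geq. Qed.

Lemma pochS n : poch n.+1 = poch n * (1 - q ^+ n.+1).
Proof. by rewrite /qpoch_part big_nat_recr. Qed.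

Hypothesis q_lt1 : `|q| < 1.

Lemma subX_neq0 n : (0 < n)%N -> 1 - q ^+ n != 0.
Proof.
move=> n0; rewrite subr_eq0; apply/negP => /eqP h.
have : `|q ^+ n| < 1 by rewrite normrX exprn_ilt1 // -lt0n.
by rewrite -h normr1 ltxx.
Qed.

Lemma poch_neq0 n : poch n != 0.
Proof. by elim: n => [|n IH]; rewrite ?poch0 ?oner_eq0 // pochS mulf_neq0 // subX_neq0. Qed.

Hypothesis cK : abs_complete K.

Let q1 : `|q| != 1. Proof. by rewrite lt_eqF. Qed.

(** The inverses [1 / (1 - q ^ j) = 1 + q ^ j / (1 - q ^ j)] also form a convergent
    product, hence the limit is invertible. *)
Lemma poch_cvg_neq0 : poch @ \oo --> qpoch q /\ qpoch q != 0.
Proof.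
have shift : abs_summable (fun n : nat => q ^+ n.+1).
  apply: abs_summable_le (abs_summable_geo q_lt1) => n.
  by rewrite exprS normrM ler_piMl // ltW.
have cvg_poch : cvgn poch.
  have -> : poch = fun n => \prod_(i < n) (1 + - q ^+ i.+1).
    apply/funext; elim=> [|n IH]; first by rewrite big_ord0 poch0.
    by rewrite big_ord_recr /= -IH pochS.
  apply: (prod1D_cvg cK (a := fun i => - q ^+ i.+1)); apply: abs_summable_le shift => n.
  by rewrite normrN.
have /cvg_ex[l hl] : cvgn (fun n => (poch n)^-1).
  have -> : (fun n => (poch n)^-1) =
      fun n => \prod_(i < n) (1 + q ^+ i.+1 / (1 - q ^+ i.+1)).
    apply/funext; elim=> [|n IH]; first by rewrite big_ord0 poch0 invr1.
    rewrite big_ord_recr /= -IH pochS; field.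
    by rewrite subX_neq0 ?poch_neq0.
  apply: (prod1D_cvg cK (a := fun i => q ^+ i.+1 / (1 - q ^+ i.+1))).
  apply: abs_summable_le (abs_summableZ (1 - `|q|)^-1 shift) => n.
  rewrite mulrC !normrM ler_wpM2r // !normfV.
  rewrite lef_pV2 ?posrE ?normr_gt0 ?subX_neq0 ?subr_eq0 1?eq_sym //.
  rewrite ger0_norm ?subr_ge0 ?(ltW q_lt1) //.
  apply: (@le_trans _ _ (`|1| - `|q ^+ n.+1|)); last exact: lerB_dist.
  rewrite normr1 lerD2l lerN2 normrX.
  by rewrite exprS ler_piMr // exprn_ile1 // ltW.
split; first exact: cvg_poch.
have h1 : (fun n => poch n * (poch n)^-1) @ \oo --> qpoch q * l.
  by apply: cvgM => //; exact: cvg_poch.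
have h2 : (fun n => poch n * (poch n)^-1) @ \oo --> (1 : K).
  by under eq_fun do rewrite divff ?poch_neq0 //; exact: cvg_cst.
have h : qpoch q * l = 1 by apply: (cvg_unique _ h1 h2); apply: norm_hausdorff.
by apply/eqP => h0; move/eqP: h; rewrite h0 mul0r eq_sym oner_eq0.
Qed.

Lemma poch_inv_cvg : (fun n => (poch n)^-1) @ \oo --> (qpoch q)^-1.
Proof. by have [pochQ Q0] := poch_cvg_neq0; apply: cvgV. Qed.

(** Both bounds enter the dominations in Tannery's theorem. *)
Lemma poch_bounded : exists M, [/\ 0 <= M, forall n, `|poch n| <= M &
  forall n, `|(poch n)^-1| <= M].
Proof.
have [M hM] : exists M, forall n, `|poch n| <= M.
  by apply: bounded_seq; apply/cvg_ex; exists (qpoch q); case: poch_cvg_neq0.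
have [N hN] : exists N, forall n, `|(poch n)^-1| <= N.
  by apply: bounded_seq; apply/cvg_ex; exists (qpoch q)^-1; exact: poch_inv_cvg.
have M0 : 0 <= M := le_trans (normr_ge0 _) (hM 0%N).
have N0 : 0 <= N := le_trans (normr_ge0 _) (hN 0%N).
exists (M + N); split=> [|n|n]; first by rewrite addr_ge0.
  by apply: le_trans (hM n) _; rewrite lerDl.
by apply: le_trans (hN n) _; rewrite lerDr.
Qed.

End Pochhammer.

(** * Euler's pentagonal number theorem *)

Section Euler.
Variables (K : numFieldType) (q : K).
Hypothesis q_lt1 : `|q| < 1.
Local Notation poch := (qpoch_part q).
Local Notation Q := (qpoch q).
Let poch_n0 n : poch n != 0. Proof. exact: poch_neq0. Qed.

Definition shanks_term n s : K :=
  (-1) ^+ s * (poch n / poch s) * q ^+ (s * n + 'C(s.+1, 2)).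

(** Shanks' finite form of Euler's theorem.  The step from [n] to [n + 1] telescopes:
    for fixed [s] the difference of the two summands is [A (s + 1) - A s], and only
    [A (n + 1)] and the new last summand survive, which are the two new terms on the
    right. *)
Lemma shanks n : \sum_(s < n.+1) shanks_term n s =
  1 + \sum_(k < n) (-1) ^+ k.+1 * (q ^+ (k.+1 ^ 2 + 'C(k.+2, 2))
                                 + q ^+ (k.+1 ^ 2 + 'C(k.+1, 2))).
Proof.
elim: n => [|n IH].
  rewrite big_ord1 big_ord0 /shanks_term poch0 divr1 mul0n add0n bin_small //.
  by rewrite !expr0 addr0 !mulr1.
rewrite big_ord_recr [in RHS]big_ord_recr /= addrA -IH.
pose A s : K := (-1) ^+ s * (poch n / poch s) * q ^+ 'C(s.+1, 2) *
  q ^+ (s * n) * (1 - q ^+ s).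
have hA s : shanks_term n.+1 s - shanks_term n s = A s.+1 - A s.
  rewrite /A /shanks_term !pochS !bin2S !mulnS !mulSn !exprD !exprS; field.
  by rewrite poch_n0 -exprS subX_neq0.
have : \sum_(s < n.+1) (shanks_term n.+1 s - shanks_term n s) = A n.+1 - A 0%N.
  rewrite -(big_mkord xpredT (fun s => shanks_term n.+1 s - shanks_term n s)).
  by rewrite -(telescope_sumr A) //; apply: eq_bigr.
rewrite sumrB => /eqP; rewrite subr_eq => /eqP ->.
have -> : A 0%N = 0 by rewrite /A expr0 subrr mulr0.
have -> : A n.+1 = (-1) ^+ n.+1 * q ^+ (n.+1 ^ 2 + 'C(n.+1, 2)).
  rewrite /A (bin2S n.+1) pochS; set c := 'C(n.+1, 2).
  rewrite -mulnn mulnS !exprD.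
  by field; rewrite poch_n0 subX_neq0.
have -> : shanks_term n.+1 n.+1 = (-1) ^+ n.+1 * q ^+ (n.+1 ^ 2 + 'C(n.+2, 2)).
  by rewrite /shanks_term divff ?mulr1 // -mulnn.
ring.
Qed.

Hypothesis cK : abs_complete K.

Let Q0 : Q != 0. Proof. by case: (poch_cvg_neq0 q_lt1 cK). Qed.
Let pochQ : poch @ \oo --> Q. Proof. by case: (poch_cvg_neq0 q_lt1 cK). Qed.

Lemma expr_cvg0 (r : K) : `|r| < 1 -> (fun n => r ^+ n) @ \oo --> (0 : K).
Proof. by move=> /abs_summable_geo/cK[l]; apply: (has_sum_cvg0 (h := id)). Qed.

(** Only the summand with [s = 0], which is the partial product, survives in the limit. *)
Lemma shanks_cvg : (fun n => \sum_(s < n.+1) shanks_term n s) @ \oo --> Q.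
Proof.
have [M [M0 hM hMV]] := poch_bounded q_lt1 cK.
apply: (has_sum_tannery (f := fun s => if s is 0 then Q else 0)
                        (g := fun s => (M * M) * q ^+ s)) => //.
- exact/abs_summableZ/abs_summable_geo.
- move=> n s; rewrite /shanks_term !normrM normrX normrN1 expr1n mul1r.
  rewrite (ger0_norm M0) ler_pM ?mulr_ge0 //; first by rewrite ler_pM.
  rewrite !normrX; apply: ler_wiXn2l => //; first exact: ltW.
  by apply: leq_trans (bin2D_le s) _; rewrite leq_addl.
- case=> [|s].
    have -> : (fun n => shanks_term n 0) = poch.
      apply/funext => n; rewrite /shanks_term poch0 divr1 mul0n bin_small //.
      by rewrite expr0 mul1r mulr1.
    exact: pochQ.
  have -> : (fun n => shanks_term n s.+1) = fun n =>
      ((-1) ^+ s.+1 / poch s.+1 * q ^+ 'C(s.+2, 2)) * (poch n * (q ^+ s.+1) ^+ n).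
    apply/funext => n; rewrite /shanks_term exprD exprM; ring.
  rewrite -[0](mulr0 ((-1) ^+ s.+1 / poch s.+1 * q ^+ 'C(s.+2, 2))).
  apply: cvgM; first exact: cvg_cst.
  rewrite -[0](mulr0 Q); apply: cvgM; first exact: pochQ.
  by apply: expr_cvg0; rewrite normrX exprn_ilt1.
- exact: (@has_sum_single K (fun s => if s is 0 then Q else 0)).
Qed.

Hypothesis q_gt0 : 0 < `|q|.

Lemma abs_summable_pent : abs_summable (fun n : int => mono q n (pent n)).
Proof.
have tri_shift : injective (fun n : int => n + 1) by exact: addIr.
apply: abs_summable_le (abs_summable_comp tri_shift (abs_summable_tri q_gt0 q_lt1)) => n.
by rewrite norm_mono /=; apply: norm_expz_le => //; rewrite lerDr sqr_ge0.
Qed.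

Lemma euler_has_sum : has_sum (fun n : int => mono q n (pent n)) Q.
Proof.
have [L hL] := cK abs_summable_pent.
suff -> : Q = L by [].
have := shanks_cvg; have -> : (fun n => \sum_(s < n.+1) shanks_term n s) =
   (fun M => mono q 0 (pent 0) + \sum_(s < M)
     (mono q s.+1%:Z (pent s.+1%:Z) + mono q (- s.+1%:Z) (pent (- s.+1%:Z)))).
  apply/funext => n; rewrite shanks.
  have -> : pent 0 = 0 by rewrite /pent /tri.
  rewrite mono0; congr (_ + _); apply: eq_bigr => k _.
  have [e1 e2] := (pent_nat k.+1, pentN_nat k.+1).
  rewrite (@mono_even _ _ (- k.+1%:Z) k.+1%:Z _ (pent (- k.+1%:Z))) //; last first.
    by exists k.+1%:Z; lia.
  by rewrite e1 e2 /mono -!exprnP mulrDr.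
move=> h; apply: (cvg_unique _ h (has_sum_int_sym hL)); exact: norm_hausdorff.
Qed.

End Euler.

(** * Jacobi's identity for the cube of the product *)

(** A discrete Green formula: [2 k + 1] is in the kernel of the discrete Laplacian, up
    to boundary terms.  At the left end the terms cancel thanks to the antisymmetry. *)
Lemma sum_odd_laplacian (K : numFieldType) (a : int -> K) (B : nat) : a (-1) = - a 0 ->
  \sum_(k < B) (2 * k + 1)%:R * (a (k%:Z - 1) + a (k%:Z + 1)) =
  2 * (\sum_(k < B) (2 * k + 1)%:R * a k%:Z) +
  (2 * B%:R - 1) * a B%:Z - (2 * B%:R + 1) * a (B%:Z - 1).
Proof.
move=> a0; elim: B => [|B IH].
  by rewrite !big_ord0 sub0r a0; ring.
rewrite !big_ord_recr /= IH; have -> : B.+1%:Z - 1 = B by lia.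
have -> : B%:Z + 1 = B.+1 by lia.
ring.
Qed.

Section JacobiFinite.
Variables (K : numFieldType) (q : K).
Hypotheses (q0 : q != 0) (q_lt1 : `|q| < 1).
Local Notation poch := (qpoch_part q).
Let poch_n0 n : poch n != 0. Proof. exact: poch_neq0. Qed.

(** The value [0] at negative integers is the one that keeps the recurrence
    [pinv_pred] valid everywhere, so that no boundary cases occur in
    [jacobi_coef_rec]. *)
Definition pinv (m : int) : K := if m is Posz n then (poch n)^-1 else 0.

Lemma pinv_pred m : pinv (m - 1) = (1 - q ^ m) * pinv m.
Proof.
case: m => [[|n]|n].
- by rewrite sub0r expr0z subrr mul0r.
- have -> : n.+1%:Z - 1 = n%:Z by lia.
  by rewrite /= -exprnP pochS; field; rewrite poch_n0 subX_neq0.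
- by rewrite /= mulr0; case E: (Negz n - 1) => [m|m] //; lia.
Qed.

(** The coefficient of [z ^ k] in the finite triple product
    [prod_(1 <= i <= N) (1 - z q^i) * prod_(0 <= i <= N) (1 - q^i / z)], which is
    [(-1)^k q^(k (k + 1) / 2)] times a Gaussian binomial coefficient. *)
Definition jacobi_coef (N : nat) (k : int) : K :=
  mono q k (tri (k + 1)) * poch (2 * N).+1 * (pinv (N%:Z - k) * pinv (N%:Z + 1 + k)).

(** Multiplication of the finite triple product by the two factors
    [(1 - z q^(N + 1)) (1 - q^(N + 1) / z)]. *)
Lemma jacobi_coef_rec N k : jacobi_coef N.+1 k =
  (1 + q ^+ N.+1 ^+ 2) * jacobi_coef N k -
  q ^+ N.+1 * (jacobi_coef N (k - 1) + jacobi_coef N (k + 1)).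
Proof.
rewrite /jacobi_coef.
set A := pinv (N.+1%:Z - k); set B := pinv (N.+1%:Z + 1 + k).
pose X := q ^+ N.+1; pose y := q ^ k.
have y0 : y != 0 by rewrite expfz_neq0.
have A1 : pinv (N%:Z - k) = (1 - X / y) * A.
  have -> : N%:Z - k = N.+1%:Z - k - 1 by lia.
  by rewrite pinv_pred expfzDr // -exprnP -invr_expz.
have A2 : pinv (N%:Z - (k + 1)) = (1 - X / (q * y)) * ((1 - X / y) * A).
  have -> : N%:Z - (k + 1) = N%:Z - k - 1 by lia.
  rewrite pinv_pred A1; congr ((1 - _) * _).
  by rewrite expfzDr // -exprnP -invr_expz /X exprS -/y; field; rewrite y0 q0.
have A3 : pinv (N%:Z - (k - 1)) = A by congr pinv; lia.
have B1 : pinv (N%:Z + 1 + k) = (1 - q * X * y) * B.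
  have -> : N%:Z + 1 + k = N.+1%:Z + 1 + k - 1 by lia.
  by rewrite pinv_pred !expfzDr // -exprnP expr1z /X /y; congr ((1 - _) * _); ring.
have B2 : pinv (N%:Z + 1 + (k - 1)) = (1 - X * y) * ((1 - q * X * y) * B).
  have -> : N%:Z + 1 + (k - 1) = N%:Z + 1 + k - 1 by lia.
  rewrite pinv_pred B1; have -> : N%:Z + 1 + k = N.+1%:Z + k by lia.
  by rewrite !expfzDr // -exprnP.
have B3 : pinv (N%:Z + 1 + (k + 1)) = B by congr pinv; lia.
rewrite A1 A2 A3 B1 B2 B3.
have -> : (2 * N.+1).+1 = (2 * N).+3 by lia.
rewrite !pochS.
have -> : q ^+ (2 * N).+2 = X ^+ 2 by rewrite /X -exprM; congr (_ ^+ _); lia.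
have -> : q ^+ (2 * N).+3 = q * X ^+ 2.
  by rewrite /X -exprM -exprS; congr (_ ^+ _); lia.
have t1 : mono q k (tri (k + 1)) = mono q k (tri k) * y.
  have -> : tri (k + 1) = tri k + k by have := triE k; have := triE (k + 1); lia.
  by rewrite -{1}(addr0 k) monoD // [mono q 0 _]/mono expr0z mul1r.
have t2 : mono q (k - 1) (tri (k - 1 + 1)) = - mono q k (tri k).
  by apply: mono_odd; [exists 0; lia|congr tri; lia].
have t3 : mono q (k + 1) (tri (k + 1 + 1)) = - (mono q k (tri k) * (q * y ^+ 2)).
  have -> : tri (k + 1 + 1) = tri k + (2 * k + 1).
    by have := triE k; have := triE (k + 1 + 1); lia.
  rewrite monoD // /mono !expr1z [q ^ (_ + 1)]expfzDr // expr1z mulrC.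
  have -> : q ^ (2 * k) = y ^+ 2 by rewrite exprnP exprz_exp mulrC.
  ring.
rewrite t1 t2 t3 -/X; field; first by rewrite y0 q0.
Qed.

Lemma jacobi_coef_sym N k : jacobi_coef N (- 1 - k) = - jacobi_coef N k.
Proof.
rewrite /jacobi_coef.
have -> : mono q (-1 - k) (tri (-1 - k + 1)) = - mono q k (tri (k + 1)).
  apply: mono_odd => //; first by exists k; lia.
  by have := triE (-1 - k + 1); have := triE (k + 1); lia.
have -> : N%:Z - (-1 - k) = N%:Z + 1 + k by lia.
have -> : N%:Z + 1 + (-1 - k) = N%:Z - k by lia.
ring.
Qed.

Lemma jacobi_coef_eq0 N (k : nat) : (N < k)%N -> jacobi_coef N k = 0.
Proof.
rewrite /jacobi_coef => Nk.
case E: (N%:Z - k%:Z) => [m|m]; first by lia.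
by rewrite /= mul0r mulr0.
Qed.

(** The left side is the derivative at [z = 1] of the finite triple product, with the
    coefficients of index [k] and [- 1 - k] combined.  By the recurrence and the Green
    formula, passing from [N] to [N + 1] multiplies it by [(1 - q^(N + 1))^2]. *)
Lemma jacobi_finite N B : (N < B)%N ->
  \sum_(k < B) (2 * k + 1)%:R * jacobi_coef N k%:Z = poch N ^+ 2.
Proof.
elim: N => [|N IH] NB.
  case: B NB => // B _; rewrite big_ord_recl big1 => [|i _]; last first.
    by rewrite jacobi_coef_eq0 ?mulr0.
  have -> : jacobi_coef 0 0%N = 1.
    have tri1 : tri (0%N%:Z + 1) = 0 by have := triE (0%N%:Z + 1); lia.
    have p0 : pinv (0%N%:Z - 0%N%:Z) = 1 by rewrite subrr /= poch0 invr1.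
    have p1 : pinv (0%N%:Z + 1 + 0%N%:Z) = (poch 1)^-1 by [].
    by rewrite /jacobi_coef tri1 p0 p1 mono0 muln0 !mul1r divff.
  by rewrite poch0 expr1n addr0 mulr1.
under eq_bigr do rewrite jacobi_coef_rec mulrBr mulrCA [X in _ - X]mulrCA.
rewrite sumrB -!mulr_sumr sum_odd_laplacian; last first.
  by rewrite -[-1]subr0 jacobi_coef_sym.
have -> : B%:Z - 1 = B.-1 by lia.
rewrite !jacobi_coef_eq0 ?IH; [|lia..].
by rewrite pochS; ring.
Qed.

End JacobiFinite.

Section Jacobi.
Variable K : numFieldType.
Hypothesis cK : abs_complete K.
Variable q : K.
Hypotheses (q_gt0 : 0 < `|q|) (q_lt1 : `|q| < 1).
Local Notation poch := (qpoch_part q).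
Local Notation Q := (qpoch q).
Let q0 : q != 0. Proof. by rewrite -normr_gt0. Qed.
Let Q0 : Q != 0. Proof. by case: (poch_cvg_neq0 q_lt1 cK). Qed.
Let pochQ : poch @ \oo --> Q. Proof. by case: (poch_cvg_neq0 q_lt1 cK). Qed.

Lemma abs_summable_jacobi :
  abs_summable (fun k : nat => (2 * k + 1)%:R * mono q k (tri (k%:Z + 1))).
Proof.
apply: abs_summable_le (abs_summableZ 2 (abs_summable_sqr_geo q_lt1)) => k.
rewrite normrM norm_mono normr_nat !normrM normrX !normr_nat mulrA ler_pM //.
  by rewrite -!natrM ler_nat; nia.
rewrite -normrX exprnP; apply: norm_expz_le => //.
by have := tri_ge (k%:Z + 1); lia.
Qed.

Lemma cvg_subsequence (u : nat -> K) (l : K) (h : nat -> nat) : (forall n, (n <= h n)%N) ->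
  u @ \oo --> l -> (fun n => u (h n)) @ \oo --> l.
Proof.
move=> hn /cvgrPdist_lt ul; apply/cvgrPdist_lt => e /ul[N _ hN].
by exists N => // n /= Nn; apply: hN; apply: leq_trans Nn (hn n).
Qed.

Lemma pinv_cvg (k : nat) (h : nat -> int) : (forall n : nat, n%:Z <= h n + k%:Z) ->
  (fun n => pinv q (h n)) @ \oo --> Q^-1.
Proof.
move=> hn; apply/cvgrPdist_lt => e e0.
have [N _ hN] := cvgr_dist_lt _ _ (poch_inv_cvg q_lt1 cK) _ e0.
exists (N + k)%N => // n /= Nn; have := hn n.
case E : (h n) => [m|m] hm; last by lia.
by apply: hN => /=; lia.
Qed.

(** Jacobi's [Q ^ 3 = sum_(k >= 0) (-1)^k (2 k + 1) q^(k (k + 1) / 2)]: the Gaussian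
    binomial coefficients in [jacobi_finite] tend to [1 / Q]. *)
Lemma jacobi_has_sum :
  has_sum (fun k : nat => (2 * k + 1)%:R * mono q k (tri (k%:Z + 1))) (Q ^+ 3).
Proof.
have [L hL] := cK abs_summable_jacobi.
suff -> : Q ^+ 3 = L by [].
have [M [M0 hM hMV]] := poch_bounded q_lt1 cK.
have h1 : (fun N => \sum_(k < N.+1) (2 * k + 1)%:R * jacobi_coef q N k%:Z) @ \oo -->
    Q^-1 * L.
  apply: (has_sum_tannery (f_ := fun N k => (2 * k + 1)%:R * jacobi_coef q N k%:Z)
    (f := fun k => Q^-1 * ((2 * k + 1)%:R * mono q k (tri (k%:Z + 1))))
    (g := fun k => (M * (M * M)) * ((2 * k + 1)%:R * mono q k (tri (k%:Z + 1))))) => //.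
  - exact/abs_summableZ/abs_summable_jacobi.
  - have hp m : `|pinv q m| <= M by case: m => n /=; rewrite ?normr0.
    move=> N k; rewrite /jacobi_coef; set u := mono q _ _.
    have -> : forall x y z : K, x * (u * y * z) = (y * z) * (x * u) by move=> *; ring.
    rewrite [leLHS]normrM [leRHS]normrM ler_wpM2r //.
    rewrite [leRHS]ger0_norm ?mulr_ge0 // normrM ler_pM //.
    by rewrite normrM ler_pM.
  - move=> k; rewrite /jacobi_coef; set u := mono q _ _.
    have -> : Q^-1 * ((2 * k + 1)%:R * u) = (2 * k + 1)%:R * (u * Q * (Q^-1 * Q^-1)).
      by field.
    apply: cvgM; first exact: cvg_cst.
    apply: cvgM.
      apply: cvgM; first exact: cvg_cst.
      by apply: (@cvg_subsequence poch Q (fun n => (2 * n).+1)) => // n; lia.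
    by apply: cvgM; [apply: (@pinv_cvg k)|apply: (@pinv_cvg 0)] => n; lia.
  - exact: has_sumZ.
have h2 : (fun N => poch N ^+ 2) @ \oo --> Q ^+ 2.
  by under eq_fun do rewrite expr2; apply: cvgM.
have E : (fun N => \sum_(k < N.+1) (2 * k + 1)%:R * jacobi_coef q N k%:Z) =
    (fun N => poch N ^+ 2).
  by apply/funext => N; rewrite jacobi_finite.
rewrite E in h1.
have h : Q^-1 * L = Q ^+ 2 by apply: (cvg_unique _ h1 h2); apply: norm_hausdorff.
by rewrite exprS -h mulrA divff // mul1r.
Qed.

End Jacobi.

(** * Theta series in one variable *)

Section Theta.
Variable K : numFieldType.
Hypothesis cK : abs_complete K.
Variable q : K.
Hypotheses (q_gt0 : 0 < `|q|) (q_lt1 : `|q| < 1).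
Local Notation Q := (qpoch q).
Let q0 : q != 0. Proof. by rewrite -normr_gt0. Qed.

(** The reflection [n |-> 1 - 2 a - n] preserves the exponent and changes the parity. *)
Lemma theta_has_sum (a : int) :
  has_sum (fun n : int => mono q n (tri n + a * n)) 0.
Proof.
have shift : injective (fun n : int => n + a) by exact: addIr.
(* The exponent is [tri (n + a) - tri a]. *)
have [|L hL] := cK (f := fun n : int => mono q n (tri n + a * n)).
  apply: abs_summable_le (abs_summableZ (q ^ (- tri a))
    (abs_summable_comp shift (abs_summable_tri q_gt0 q_lt1))) => n /=.
  rewrite norm_mono -expfzDr // triD.
  by have -> : - tri a + (tri n + tri a + n * a) = tri n + a * n by lia.
rewrite (_ : 0 = L) //; symmetry.
apply: (has_sum_antisym (s := fun n => 1 - 2 * a - n)) hL => n; first by lia.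
apply: mono_odd; first by exists (a + n - 1); lia.
have := triE n; have := triE (1 - 2 * a - n); lia.
Qed.

Lemma pent0_has_sum : has_sum (fun n : int => mono q n (pent n - 0 * n)) Q.
Proof.
by apply: eq_has_sum (euler_has_sum q_lt1 cK q_gt0) => n; rewrite mul0r subr0.
Qed.

Lemma pent1_has_sum : has_sum (fun n : int => mono q n (pent n - 1 * n)) Q.
Proof.
apply: (has_sum_extend (h := -%R)); first exact: oppr_inj.
  by move=> n /(_ (- n)); rewrite opprK eqxx.
apply: eq_has_sum (euler_has_sum q_lt1 cK q_gt0) => n /=.
apply: mono_even; first by exists (- n); lia.
by rewrite pentN mul1r opprK subrK.
Qed.

(** The exponent is [3 tri n], which is invariant under [n |-> 1 - n]. *)
Lemma pent2_has_sum : has_sum (fun n : int => mono q n (pent n - 2 * n)) 0.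
Proof.
have [|L hL] := cK (f := fun n : int => mono q n (pent n - 2 * n)).
  apply: abs_summable_le (abs_summable_tri q_gt0 q_lt1) => n.
  rewrite norm_mono; apply: norm_expz_le => //.
  have := tri_ge0 n; rewrite /pent; have := triE n; have := triE (n + 1); lia.
rewrite (_ : 0 = L) //; symmetry.
apply: (has_sum_antisym (s := fun n => 1 - n)) hL => n; first by lia.
apply: mono_odd; first by exists (n - 1); lia.
by rewrite pentBS.
Qed.

End Theta.

(** Moving [n] by [m] moves the linear coefficient by [3 m], because [n ^ 2] has
    coefficient [3 / 2] in [pent n]. *)
Lemma pent_has_sum (K : numFieldType) (q : K) (m a : int) (l : K) : q != 0 ->
  has_sum (fun n : int => mono q n (pent n - a * n)) l ->
  has_sum (fun n : int => mono q n (pent n - (3 * m + a) * n))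
    (mono q m (pent m - (3 * m + a) * m) * l).
Proof.
move=> q0 hl; apply: (has_sum_extend (h := fun n => n + m)); first exact: addIr.
  by move=> n /(_ (n - m)); rewrite subrK eqxx.
apply: eq_has_sum (has_sumZ (c := mono q m (pent m - (3 * m + a) * m)) hl) => n /=.
rewrite -monoD //; apply: mono_even; first by exists 0; lia.
rewrite pentD; lia.
Qed.

(** * The triple family *)

Section Family.
Variables (K : numFieldType) (q : K).

(** The triple family described at the beginning, with [k] and [j] lowered by one so
    that they range over the natural numbers. *)
Definition appell_term (c : int) (p : int * (nat * nat)) : K :=
  p.2.1.+1%:R ^+ 2 * mono q (p.1 + p.2.1%:Z + p.2.2%:Z)
    (c * p.1 ^+ 2 + tri (p.1 + 1) - p.1 * (p.2.2%:Z + 1)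
     + tri (p.2.1%:Z + p.2.2%:Z + 2)).

Lemma appell_term_split c n k j : q != 0 ->
  appell_term c (n, (k, j)) =
  k.+1%:R ^+ 2 * mono q (k%:Z + j%:Z) (tri (k%:Z + j%:Z + 2)) *
  mono q n (c * n ^+ 2 + tri (n + 1) - n * (j%:Z + 1)).
Proof.
move=> q0; rewrite -mulrA -monoD // /appell_term /=; congr (_ * _); apply: mono_even; last by lia.
by exists 0; lia.
Qed.

(** Writing [j + 1 = 3 m + a] reduces the sum over [n] to the three cases
    [a = 0, 1, 2]. *)
Lemma appell1_has_sum k j (m a : int) l : q != 0 -> j%:Z + 1 = 3 * m + a ->
  has_sum (fun n : int => mono q n (pent n - a * n)) l ->
  has_sum (fun n => appell_term 1 (n, (k, j)))
    (k.+1%:R ^+ 2 * mono q (k%:Z + j%:Z + m)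
      (tri (k%:Z + j%:Z + 2) + pent m - (3 * m + a) * m) * l).
Proof.
move=> q0 hj hl.
rewrite -[_ + pent m - _]addrA monoD //.
set u := mono q _ (tri _); set v := mono q m _.
have -> : forall x : K, x * (u * v) * l = x * u * (v * l) by move=> x; ring.
apply: eq_has_sum (has_sumZ (pent_has_sum (m := m) q0 hl)) => n; rewrite appell_term_split //.
by congr (_ * mono q _ _); rewrite hj /pent; lia.
Qed.

(** What remains of the terms with [n] and [- n] together, [x] being [q ^ n], once the
    factors that depend on [n] alone are removed. *)
Definition appell_kernel (x : K) (p : nat * nat) : K :=
  p.1.+1%:R ^+ 2 * mono q (p.1%:Z + p.2%:Z) (tri (p.1%:Z + p.2%:Z + 2)) *
  (x^-1 ^+ p.2.+1 + x ^+ p.2).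

Lemma appell_term_pair (n k j : nat) (x := q ^+ n) : q != 0 ->
  (appell_term 1 (n%:Z, (k, j)) - appell_term 0 (n%:Z, (k, j))) +
  (appell_term 1 (- n%:Z, (k, j)) - appell_term 0 (- n%:Z, (k, j))) =
  (-1) ^+ n * (q ^+ (n ^ 2)%N - 1) * q ^+ (n * n.+1)./2 * appell_kernel x (k, j).
Proof.
move=> q0; have x0 : x != 0 by rewrite expf_neq0.
have t1 : tri (n%:Z + 1) = ((n * n.+1)./2)%:Z.
  have -> : n%:Z + 1 = n.+1 by lia.
  by rewrite tri_bin bin2 mulnC.
have xe (m : nat) : q ^ (n%:Z * m%:Z) = x ^+ m by rewrite -exprz_exp -!exprnP.
rewrite !appell_term_split // /appell_kernel /=.
set W := _ * mono q (k%:Z + j%:Z) _.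
have e1 c : mono q n (c * n%:Z ^+ 2 + tri (n%:Z + 1) - n%:Z * (j%:Z + 1)) =
  (-1) ^+ n * q ^ (c * n%:Z ^+ 2) * q ^+ (n * n.+1)./2 * x^-1 ^+ j.+1.
  have -> : j%:Z + 1 = j.+1 by lia.
  by rewrite /mono !expfzDr // -invr_expz xe t1 -exprVn -!exprnP; ring.
have e2 c : mono q (- n%:Z)
    (c * (- n%:Z) ^+ 2 + tri (- n%:Z + 1) - - n%:Z * (j%:Z + 1)) =
  (-1) ^+ n * q ^ (c * n%:Z ^+ 2) * q ^+ (n * n.+1)./2 * x ^+ j.
  rewrite sqrrN [- n%:Z + 1]addrC triNS.
  have -> : c * n%:Z ^+ 2 + tri n - - n%:Z * (j%:Z + 1) =
      c * n%:Z ^+ 2 + tri (n%:Z + 1) + n%:Z * j%:Z.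
    by rewrite triD; have : tri 1 = 0 by []; lia.
  by rewrite /mono !expfzDr // xe t1 -invr_expz -!exprnP invr_sign; ring.
rewrite !e1 !e2 mul0r expr0z mul1r.
have -> : q ^ (n%:Z ^+ 2) = q ^+ (n ^ 2)%N by rewrite -mulnn expr2 -PoszM.
ring.
Qed.

End Family.

(** The quadratic form in [n] and [j] is only semidefinite for [c = 0]; the linear term
    in [j] comes from [k j] in [tri (k + j)], which explains
    the restriction to [k >= 1] in the unshifted indices. *)
Lemma appell_exp_ge (c n k j : int) : 0 <= c -> 0 <= k -> 0 <= j ->
  tri (n - j) + (k + j) <=
  c * n ^+ 2 + tri (n + 1) - n * (j + 1) + tri (k + j + 2).
Proof.
move=> c0 k0 j0; have := triE (n - j); have := triE (n + 1).
have := triE (k + j + 2); have := mulr_ge0 c0 (sqr_ge0 n).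
have := mulr_ge0 k0 k0; have := mulr_ge0 k0 j0.
lia.
Qed.

Section FamilySums.
Variable K : numFieldType.
Variable q : K.
Hypotheses (q_gt0 : 0 < `|q|) (q_lt1 : `|q| < 1).
Let q0 : q != 0. Proof. by rewrite -normr_gt0. Qed.

Lemma abs_summable_appell (c : int) : 0 <= c -> abs_summable (appell_term q c).
Proof.
move=> c0.
(* In the coordinates [n - j], [k], [j] the bound is a product of three factors. *)
have inj : injective (fun p : int * (nat * nat) => (p.1 - p.2.2%:Z, p.2)).
  by move=> [n [k j]] [n' [k' j']] /= [h -> hj]; congr (_, (_, _)) => //; lia.
have bnd := abs_summable_prod (abs_summable_tri q_gt0 q_lt1)
  (abs_summable_prod (abs_summable_sqr_geo q_lt1) (abs_summable_geo q_lt1)).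
apply: abs_summable_le (abs_summable_comp inj bnd) => -[n [k j]] /=.
rewrite /appell_term /=; set u := mono q _ _; set a := k.+1%:R ^+ 2.
have -> : q ^ tri (n - j%:Z) * (a * q ^+ k * q ^+ j) =
  a * (q ^ tri (n - j%:Z) * q ^+ k * q ^+ j) by ring.
rewrite [leLHS]normrM [leRHS]normrM norm_mono.
rewrite ler_wpM2l // !exprnP -!expfzDr //; apply: norm_expz_le => //.
by rewrite -addrA; apply: appell_exp_ge.
Qed.

Lemma abs_summable_appell_diff : abs_summable (fun p => appell_term q 1 p - appell_term q 0 p).
Proof.
have h1 : abs_summable (appell_term q 1) by apply: abs_summable_appell.
have h0 : abs_summable (appell_term q 0) by apply: abs_summable_appell.
have := abs_summableD h1 (abs_summableZ (-1) h0).
by apply: abs_summable_le => p; rewrite mulN1r.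
Qed.

Hypothesis cK : abs_complete K.

Lemma appell0_has_sum kj : has_sum (fun n => appell_term q 0 (n, kj)) 0.
Proof.
case: kj => k j.
rewrite -(mulr0 (k.+1%:R ^+ 2 * mono q (k%:Z + j%:Z) (tri (k%:Z + j%:Z + 2)))).
apply: eq_has_sum (has_sumZ (theta_has_sum cK q_gt0 q_lt1 (- j%:Z))) => n.
rewrite appell_term_split //.
congr (_ * mono q _ _); have := triD n 1; have : tri 1 = 0 by []. lia.
Qed.

End FamilySums.

(** * Summing over n first: the Hecke-type double sum *)

Lemma hecke_expE (n m : int) :
  hecke_exp n m = tri (n + 2) - 1 + 3 * n * m + 3 * m ^+ 2 + 4 * m.
Proof.
rewrite /hecke_exp; congr (_ + _ + _ + _).
have -> : n ^+ 2 + 3 * n = 2 * (tri (n + 2) - 1) by have := triE (n + 2); lia.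
by rewrite mulKz.
Qed.

Lemma hecke_exp_ge (p : int * int) : nonneg_pair p || neg_pair p ->
  `|p.1| + `|p.2| - 1 <= hecke_exp p.1 p.2.
Proof.
case: p => n m; rewrite /nonneg_pair /neg_pair /= => h.
have hnm : 0 <= n * m by nia.
have := triE (n + 2); rewrite hecke_expE.
have := sqr_ge0 n; have := sqr_ge0 m.
case/orP: h => /andP[]; nia.
Qed.

Lemma appell_exp_nonneg (k j m : int) : j + 1 = 3 * m + 1 ->
  tri (k + j + 2) + pent m - (3 * m + 1) * m = hecke_exp k m + 1.
Proof.
move=> hj; have -> : j = 3 * m by lia.
rewrite hecke_expE /pent; have := triE (k + 3 * m + 2); have := triE (k + 2).
by have := triE (m + 1); lia.
Qed.

Lemma appell_exp_neg (k j m : int) : j + 1 = 3 * (m + 1) + 0 ->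
  tri (k + j + 2) + pent (m + 1) - (3 * (m + 1) + 0) * (m + 1) =
  hecke_exp (- k - 2) (- m - 1) + 1.
Proof.
move=> hj; have -> : j = 3 * m + 2 by lia.
rewrite hecke_expE /pent.
have -> : - k - 2 + 2 = 1 - (k + 1) by ring.
rewrite triNS; have := triE (k + (3 * m + 2) + 2); have := triE (k + 1).
have := triE (m + 1 + 1); rewrite !expr2; lia.
Qed.

(** The negative pairs that carry a nonzero term: the factor [(n + 1) ^ 2] vanishes for
    [n = -1]. *)
Definition neg_index (p : nat * nat) : int * int := (- p.1%:Z - 2, - p.2%:Z - 1).

Lemma neg_index_inj : injective neg_index.
Proof. by move=> [a b] [c d] [? ?]; congr (_, _); lia. Qed.

Section HeckeReindex.
Variables (K : numFieldType) (q : K).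

Lemma hecke_nonneg_has_sum S1 : has_sum (on_pairs nonneg_pair (hecke_term q)) S1 ->
  has_sum (fun p : nat * nat => hecke_term q (p.1%:Z, p.2%:Z)) S1.
Proof.
pose nonneg_index (p : nat * nat) : int * int := (p.1%:Z, p.2%:Z).
move=> h; have := @has_sum_restrict _ _ _ nonneg_index _ _ _ _ h.
apply=> [[a b] [c d] [-> ->] //|[n m] hi]; rewrite /on_pairs /nonneg_pair /=.
by case: n hi => n; case: m => m // /(_ (n, m)); rewrite eqxx.
Qed.

Lemma hecke_neg_support (n m : int) : (forall p, neg_index p != (n, m)) ->
  on_pairs neg_pair (hecke_term q) (n, m) = 0.
Proof.
move=> hi; rewrite /on_pairs; case: ifP => //; rewrite /neg_pair /= => /andP[n0 m0].
have [->|n1] := eqVneq n (-1).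
  by rewrite /hecke_term /= addNr expr0n /= mulr0 mul0r.
have := hi (`|(n + 2)%R|%N, `|(m + 1)%R|%N); rewrite /neg_index /=.
have -> : - `|(n + 2)%R|%N%:Z - 2 = n by lia.
have -> : - `|(m + 1)%R|%N%:Z - 1 = m by lia.
by rewrite eqxx.
Qed.

Lemma hecke_neg_has_sum S2 : has_sum (on_pairs neg_pair (hecke_term q)) S2 ->
  has_sum (fun p => hecke_term q (neg_index p)) S2.
Proof.
move=> h; have := has_sum_restrict neg_index_inj _ h.
move=> hh; apply: eq_has_sum (hh _) => [p|[n m]]; last exact: hecke_neg_support.
by rewrite /= /on_pairs /neg_pair; case: ifP => //=; lia.
Qed.

End HeckeReindex.

Section HeckeSide.
Variable K : numFieldType.
Variable q : K.
Hypotheses (q_gt0 : 0 < `|q|) (q_lt1 : `|q| < 1).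
Local Notation Q := (qpoch q).
Let q0 : q != 0. Proof. by rewrite -normr_gt0. Qed.

Lemma abs_summable_hecke (P : pred (int * int)) :
  (forall p, P p -> nonneg_pair p || neg_pair p) ->
  abs_summable (on_pairs P (hecke_term q)).
Proof.
move=> hP.
have bnd := abs_summableZ q^-1 (abs_summable_prod
  (abs_summable_absz (abs_summable_sqr_geo q_lt1))
  (abs_summable_absz (abs_summable_geo q_lt1))).
apply: abs_summable_le bnd => -[n m]; rewrite /on_pairs.
case: ifP => [/hP h|_]; last by rewrite normr0.
rewrite /hecke_term /=.
have -> : (-1) ^ n * ((n + 1) ^+ 2)%:~R * q ^ hecke_exp n m =
  ((n + 1) ^+ 2)%:~R * mono q n (hecke_exp n m) by rewrite /mono; ring.
set u := mono _ _ _; set a := `|n|.+1%:R ^+ 2.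
have -> : q^-1 * (a * q ^+ `|n| * q ^+ `|m|) =
  a * (q^-1 * q ^+ `|n| * q ^+ `|m|) by ring.
rewrite [leLHS]normrM [leRHS]normrM norm_mono ler_pM //.
  rewrite rmorphXn /= !normrX lerXn2r ?nnegrE // normr_nat.
  by rewrite -intr_norm -[leRHS]/(`|n|.+1%:Z%:~R) ler_int; lia.
rewrite -exprN1 !exprnP -!expfzDr //; apply: norm_expz_le => //.
by have := hecke_exp_ge h; rewrite /=; lia.
Qed.

Hypothesis cK : abs_complete K.

(** After summation over [n] the terms with [j = 3 m] form the nonnegative cone, those
    with [j = 3 m + 2] the negative cone with the opposite sign, and those with
    [j = 3 m + 1] vanish. *)
Lemma appell_sum_hecke (S1 S2 V : K) :
  has_sum (on_pairs nonneg_pair (hecke_term q)) S1 ->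
  has_sum (on_pairs neg_pair (hecke_term q)) S2 ->
  has_sum (fun p => appell_term q 1 p - appell_term q 0 p) V ->
  V = q * Q * (S1 - S2).
Proof.
move=> /hecke_nonneg_has_sum h1 /hecke_neg_has_sum h2 hV.
pose G1 (p : nat * nat) : K :=
  if (p.2 %% 3 == 0)%N then q * Q * hecke_term q (p.1%:Z, (p.2 %/ 3)%N%:Z) else 0.
pose G2 (p : nat * nat) : K := if (p.2 %% 3 == 2)%N then
  - (q * Q) * hecke_term q (neg_index (p.1, p.2 %/ 3)%N) else 0.
have hG1 : has_sum G1 (q * Q * S1).
  apply: (has_sum_extend (h := fun p : nat * nat => (p.1, 3 * p.2)%N)).
  - by move=> [a b] [c d] [-> ?]; congr (_, _); lia.
  - move=> [k j] /(_ (k, j %/ 3)%N) /= hj; rewrite /G1 /=; case: eqP => // j0.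
    by case/eqP: hj; congr (_, _); lia.
  apply: eq_has_sum (has_sumZ h1) => -[k m] /=.
  by rewrite /G1 /= mulnC modnMl mulnK.
have hG2 : has_sum G2 (- (q * Q) * S2).
  apply: (has_sum_extend (h := fun p : nat * nat => (p.1, 3 * p.2 + 2)%N)).
  - by move=> [a b] [c d] [-> ?]; congr (_, _); lia.
  - move=> [k j] /(_ (k, j %/ 3)%N) /= hj; rewrite /G2 /=; case: eqP => // j0.
    by case/eqP: hj; congr (_, _); lia.
  apply: eq_has_sum (has_sumZ h2) => -[k m] /=.
  have m2 : ((3 * m + 2) %% 3 = 2)%N by lia.
  have m3 : ((3 * m + 2) %/ 3 = m)%N by lia.
  by rewrite /G2 /= m2 m3.
have hswap : has_sum (fun p : (nat * nat) * int =>
    appell_term q 1 (p.2, p.1) - appell_term q 0 (p.2, p.1)) V.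
  apply: (has_sum_restrict (h := fun p : (nat * nat) * int => (p.2, p.1))) hV.
    by move=> [a b] [c d] [-> ->].
  by move=> [n kj] /(_ (kj, n)); rewrite eqxx.
suff fib kj : has_sum (fun n => appell_term q 1 (n, kj) - appell_term q 0 (n, kj)) (G1 kj + G2 kj).
  have := has_sum_prod fib hswap.
  have := has_sumD hG1 hG2; move=> a b; rewrite (has_sum_unique b a); ring.
case: kj => k j.
rewrite -[G1 _ + G2 _]subr0.
apply: has_sumD; last first.
  by apply: has_sumN; apply: (appell0_has_sum q_gt0 q_lt1 cK).
have jdiv := divn_eq j 3; have : (j %% 3 < 3)%N by rewrite ltn_mod.
rewrite /G1 /G2 /=; move: jdiv; set m := (j %/ 3)%N => jdiv.
have monoS (n' e : int) : mono q n' (e + 1) = q * ((-1) ^ n' * q ^ e).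
  by rewrite /mono expfzDr // expr1z; ring.
case: (j %% 3)%N jdiv => [|[|[|//]]] jm _ /=.
- have hj : j%:Z + 1 = 3 * m%:Z + 1 by lia.
  have := appell1_has_sum (k := k) q0 hj (pent1_has_sum cK q_gt0 q_lt1).
  congr has_sum; rewrite addr0 /hecke_term /=.
  rewrite (_ : mono q _ _ = mono q k (hecke_exp k m + 1)); last first.
    apply: mono_even; first by exists (- 2 * m%:Z); lia.
    exact: appell_exp_nonneg.
  rewrite monoS rmorphXn /=; have -> : k%:Z + 1 = k.+1 by lia.
  ring.
- have hj : j%:Z + 1 = 3 * m%:Z + 2 by lia.
  have := appell1_has_sum (k := k) q0 hj (pent2_has_sum cK q_gt0 q_lt1).
  by congr has_sum; rewrite addr0 mulr0.
- have hj : j%:Z + 1 = 3 * (m%:Z + 1) + 0 by lia.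
  have := appell1_has_sum (k := k) q0 hj (pent0_has_sum cK q_gt0 q_lt1).
  congr has_sum; rewrite add0r /hecke_term /neg_index /=.
  rewrite (_ : mono q _ _ = - mono q (- k%:Z - 2)
    (hecke_exp (- k%:Z - 2) (- m%:Z - 1) + 1)); last first.
    apply: mono_odd; first by exists (- k%:Z - 2 * m%:Z - 3); lia.
    exact: appell_exp_neg.
  rewrite monoS rmorphXn /=; have -> : - k%:Z - 2 + 1 = - k.+1%:Z by lia.
  rewrite rmorphN /=; ring.
Qed.

End HeckeSide.

(** * Summing over k and j first: the left-hand side *)

(** Solution of the recurrence [B (s + 1) = x B s + (s + 1) ^ 2], [B 0 = 0]. *)
Lemma sum_sqr_geo (K : numFieldType) (x : K) s :
  (1 - x) ^+ 3 * (\sum_(i < s) i.+1%:R ^+ 2 * x ^+ (s - i).-1) =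
  - (x * (1 + x) * x ^+ s) + (1 - x) ^+ 2 * s%:R ^+ 2
  - 2 * x * (1 - x) * s%:R + x * (1 + x).
Proof.
elim: s => [|s IH]; first by rewrite big_ord0 expr0; ring.
have -> : \sum_(i < s.+1) i.+1%:R ^+ 2 * x ^+ (s.+1 - i).-1 =
    x * (\sum_(i < s) i.+1%:R ^+ 2 * x ^+ (s - i).-1) + s.+1%:R ^+ 2.
  rewrite big_ord_recr /= subSnn expr0 mulr1 mulr_sumr; congr (_ + _).
  apply: eq_bigr => i _; rewrite subSn 1?ltnW // mulrCA -exprS prednK //.
  by rewrite subn_gt0.
move: IH; set B := \sum_(_ < s) _ => IH.
have -> : (1 - x) ^+ 3 * (x * B + s.+1%:R ^+ 2) =
  x * ((1 - x) ^+ 3 * B) + (1 - x) ^+ 3 * s.+1%:R ^+ 2 by ring.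
rewrite IH (exprS x s); ring.
Qed.

(** In the symmetric combination the quadratic term in [s] cancels, and the linear one
    becomes the weight of Jacobi's series. *)
Lemma sum_sqr_geo_sym (K : numFieldType) (x : K) s : x != 0 -> 1 - x != 0 ->
  \sum_(i < s) i.+1%:R ^+ 2 * (x^-1 ^+ (s - i) + x ^+ (s - i).-1) =
  - ((1 + x) / (1 - x) ^+ 2) *
    ((2 * s + 1)%:R + (x ^+ s.+1 - x^-1 ^+ s) / (1 - x)).
Proof.
move=> x0 x1; pose y := x^-1.
have y1 : 1 - y != 0.
  have -> : 1 - y = - (1 - x) / x by rewrite /y; field.
  by rewrite mulf_neq0 ?oppr_eq0 ?invr_eq0.
have h (z : K) : 1 - z != 0 -> \sum_(i < s) i.+1%:R ^+ 2 * z ^+ (s - i).-1 =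
    (- (z * (1 + z) * z ^+ s) + (1 - z) ^+ 2 * s%:R ^+ 2
     - 2 * z * (1 - z) * s%:R + z * (1 + z)) / (1 - z) ^+ 3.
  by move=> z1; rewrite -sum_sqr_geo mulrC mulKf // expf_neq0.
have -> : \sum_(i < s) i.+1%:R ^+ 2 * (x^-1 ^+ (s - i) + x ^+ (s - i).-1) =
    y * (\sum_(i < s) i.+1%:R ^+ 2 * y ^+ (s - i).-1) +
    \sum_(i < s) i.+1%:R ^+ 2 * x ^+ (s - i).-1.
  rewrite mulr_sumr -big_split /=; apply: eq_bigr => i _.
  by rewrite mulrDr mulrCA -exprS prednK // subn_gt0.
rewrite !h // -/y; set ys := y ^+ s.
rewrite (exprS x s).
have xy : x = y^-1 by rewrite invrK.
have y0 : y != 0 by rewrite invr_eq0.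
have xs : x ^+ s = ys^-1 by rewrite /ys exprVn invrK.
rewrite xs -/y xy; field.
by rewrite y0 y1 expf_neq0 // -opprB oppr_eq0 y1.
Qed.

(** Listed along the antidiagonals, [s - 1] being the sum of the two entries, because the
    closed form is available for each antidiagonal. *)
Definition triangle (M : nat) : seq (nat * nat) :=
  [seq (i, (s - i).-1) | s <- iota 0 M, i <- iota 0 s].

Lemma triangle_uniq M : uniq (triangle M).
Proof.
apply: allpairs_uniq_dep => [|s _|]; try exact: iota_uniq.
move=> [s i] [s' i'] /allpairsPdep[t [u [_ hu]]] [-> ->].
move=> /allpairsPdep[t' [u' [_ hu']]] [-> ->] /= [hi hs].
move: hu hu'; rewrite !mem_iota => hu hu'.
have e : t = t' by lia.
by subst.
Qed.

Lemma mem_triangle M p : (p.1 + p.2 + 1 < M)%N -> p \in triangle M.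
Proof.
case: p => k j /= h; apply/allpairsPdep; exists (k + j + 1)%N, k.
by split; [rewrite mem_iota; lia|rewrite mem_iota; lia|congr (_, _); lia].
Qed.

Lemma sum_triangle (K : numFieldType) M (f : nat * nat -> K) :
  \sum_(p <- triangle M) f p = \sum_(s < M) \sum_(i < s) f (val i, (s - i).-1).
Proof.
rewrite big_allpairs_dep /=.
rewrite -(big_mkord xpredT (fun s => \sum_(i < s) f (val i, (s - i).-1))).
rewrite /index_iota subn0; apply: eq_bigr => s _.
by rewrite -(big_mkord xpredT (fun i => f (i, (s - i).-1))) /index_iota subn0.
Qed.

Section LeftSide.
Variable K : numFieldType.
Hypothesis cK : abs_complete K.
Variable q : K.
Hypotheses (q_gt0 : 0 < `|q|) (q_lt1 : `|q| < 1).
Local Notation Q := (qpoch q).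
Let q0 : q != 0. Proof. by rewrite -normr_gt0. Qed.
Let Q0 : Q != 0. Proof. by case: (poch_cvg_neq0 q_lt1 cK). Qed.

(** Grouping by [k + j] and inserting the closed form leaves Jacobi's series, with limit
    [Q ^ 3], and a theta series, with limit [0]. *)
Lemma appell_kernel_cvg (n : nat) (x := q ^+ n.+1) :
  (fun M => \sum_(p <- triangle M) appell_kernel q x p) @ \oo -->
  (1 + x) / (1 - x) ^+ 2 * Q ^+ 3.
Proof.
have x1 : 1 - x != 0 by apply: subX_neq0.
have x0 : x != 0 by rewrite expf_neq0.
have mX s e e' : mono q s e * q ^ e' = mono q s (e + e').
  by rewrite /mono -mulrA -expfzDr.
pose f (N : int) := mono q N (tri N + n.+1%:Z * N).
have hf := has_sum_int_paired (theta_has_sum cK q_gt0 q_lt1 n.+1).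
have hJ := has_sum_series (jacobi_has_sum cK q_gt0 q_lt1).
have -> : (fun M => \sum_(p <- triangle M) appell_kernel q x p) = fun M =>
   (1 + x) / (1 - x) ^+ 2 * (\sum_(s < M) (2 * s + 1)%:R * mono q s (tri (s%:Z + 1)))
   - (1 + x) / (1 - x) ^+ 3 * (\sum_(s < M) (f s.+1%:Z + f (- s%:Z))).
  apply/funext => M; rewrite sum_triangle !mulr_sumr -sumrB; apply: eq_bigr => s _.
  have xe (m : nat) : q ^ (n.+1%:Z * m%:Z) = x ^+ m.
    by rewrite -exprz_exp -!exprnP.
  have f1 : f s.+1%:Z = - (mono q s (tri (s%:Z + 1)) * x ^+ s.+1).
    rewrite /f -xe mX.
    by apply: mono_odd; [exists (-1); lia|congr (tri _ + _); lia].
  have f2 : f (- s%:Z) = mono q s (tri (s%:Z + 1)) * x^-1 ^+ s.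
    rewrite exprVn -xe invr_expz mX.
    apply: mono_even; first by exists s%:Z; lia.
    by rewrite -triNS; congr (tri _ + _); lia.
  transitivity (- mono q s (tri (s%:Z + 1)) *
     \sum_(i < s) i.+1%:R ^+ 2 * (x^-1 ^+ (s - i) + x ^+ (s - i).-1)).
    rewrite mulr_sumr; apply: eq_bigr => i _; rewrite /appell_kernel /=.
    have is_ := ltn_ord i.
    rewrite prednK ?subn_gt0 // (_ : mono q (_ + _) _ = - mono q s (tri (s%:Z + 1))).
      by ring.
    by apply: mono_odd; [exists 0; lia|congr tri; lia].
  rewrite sum_sqr_geo_sym // f1 f2; field.
  exact: x1.
have -> : (1 + x) / (1 - x) ^+ 2 * Q ^+ 3 =
  (1 + x) / (1 - x) ^+ 2 * Q ^+ 3 - (1 + x) / (1 - x) ^+ 3 * 0.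
  by rewrite mulr0 subr0.
apply: cvgB; (apply: cvgM; first exact: cvg_cst); [exact: hJ|exact: hf].
Qed.

(** The sums [g n] over the fibers of [n] satisfy [g 0 = 0], and [g n + g (- n)] is
    [- Q ^ 3] times the [n]-th term of the left-hand side. *)
Lemma lhs_cvg V : has_sum (fun p => appell_term q 1 p - appell_term q 0 p) V ->
  (fun M => - Q ^+ 3 * \sum_(s < M) lhs_term q s.+1) @ \oo --> V.
Proof.
move=> hV.
have /choice[g hg] (n : int) :
    exists l, has_sum (fun kj => appell_term q 1 (n, kj) - appell_term q 0 (n, kj)) l.
  apply: cK.
  apply: (abs_summable_comp (h := fun kj => (n, kj)))
    (abs_summable_appell_diff q_gt0 q_lt1).
  by move=> a b [].
have g0 : g 0 = 0.
  apply: has_sum_unique (hg 0) _.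
  rewrite -[X in has_sum _ X](mul0r (g 0)).
  apply: eq_has_sum (has_sumZ (hg 0)) => -[k j].
  by rewrite mul0r !appell_term_split // expr0n /= mulr0 mul0r subrr.
have gg s : g s.+1%:Z + g (- s.+1%:Z) = - Q ^+ 3 * lhs_term q s.+1.
  have hs := has_sumD (hg s.+1%:Z) (hg (- s.+1%:Z)).
  have hmem (p : nat * nat) : \forall M \near \oo, p \in triangle M.
    by exists (p.1 + p.2 + 2)%N => // M /= hM; apply: mem_triangle; lia.
  have h1 := has_sum_exhaust triangle_uniq hmem hs.
  pose c : K := (-1) ^+ s.+1 * (q ^+ (s.+1 ^ 2)%N - 1) * q ^+ (s.+1 * s.+2)./2.
  pose x := q ^+ s.+1.
  have h2 : (fun M => c * \sum_(p <- triangle M) appell_kernel q x p) @ \oo -->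
      c * ((1 + x) / (1 - x) ^+ 2 * Q ^+ 3).
    by apply: cvgM; [exact: cvg_cst|exact: appell_kernel_cvg].
  have E : (fun M => \sum_(p <- triangle M)
      (appell_term q 1 (s.+1%:Z, p) - appell_term q 0 (s.+1%:Z, p) +
      (appell_term q 1 (- s.+1%:Z, p) - appell_term q 0 (- s.+1%:Z, p)))) =
      fun M => c * \sum_(p <- triangle M) appell_kernel q x p.
    apply/funext => M; rewrite mulr_sumr; apply: eq_bigr => -[k j] _.
    by rewrite appell_term_pair.
  rewrite E in h1; rewrite (cvg_unique (@norm_hausdorff _ _) h1 h2).
  rewrite /lhs_term /c /x; field.
  by apply: subX_neq0.
have := has_sum_int_sym (has_sum_prod hg hV).
have -> // : (fun M : nat => g 0 + \sum_(s < M) (g s.+1%:Z + g (- s.+1%:Z))) =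
  fun M => - Q ^+ 3 * \sum_(s < M) lhs_term q s.+1.
apply/funext => M; rewrite g0 add0r mulr_sumr; apply: eq_bigr => s _; exact: gg.
Qed.

Lemma hecke_identity :
  [/\ cvgn (fun N : nat => \sum_(1 <= n < N) lhs_term q n),
      cvgn (qpoch_part q) /\ qpoch q != 0,
      cvg (partial_sum (on_pairs nonneg_pair (hecke_term q)) @ totally),
      cvg (partial_sum (on_pairs neg_pair (hecke_term q)) @ totally)
    & \big[+%R/0]_(1 <= n <oo) lhs_term q n =
      - (q / qpoch q ^+ 2) *
        (sum (on_pairs nonneg_pair (hecke_term q)) -
         sum (on_pairs neg_pair (hecke_term q)))].
Proof.
have [pochQ _] := poch_cvg_neq0 q_lt1 cK.
have [S1 hS1] : exists S1, has_sum (on_pairs nonneg_pair (hecke_term q)) S1.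
  by apply: cK; apply: (abs_summable_hecke q_gt0 q_lt1) => p ->.
have [S2 hS2] : exists S2, has_sum (on_pairs neg_pair (hecke_term q)) S2.
  by apply: cK; apply: (abs_summable_hecke q_gt0 q_lt1) => p ->; rewrite orbT.
have [V hV] : exists V, has_sum (fun p => appell_term q 1 p - appell_term q 0 p) V.
  by apply: cK; exact: (abs_summable_appell_diff q_gt0 q_lt1).
have VE := appell_sum_hecke q_gt0 q_lt1 cK hS1 hS2 hV.
have cvg_lhs : (fun N : nat => \sum_(1 <= n < N) lhs_term q n) @ \oo -->
    - (q / qpoch q ^+ 2) * (S1 - S2).
  rewrite -cvg_shiftS /=.
  have -> : (fun N => \sum_(1 <= n < N.+1) lhs_term q n) = fun N =>
      - (qpoch q ^+ 3)^-1 * (- qpoch q ^+ 3 * \sum_(s < N) lhs_term q s.+1).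
    apply/funext => N; rewrite big_add1 /= big_mkord; field; exact: Q0.
  have -> : - (q / qpoch q ^+ 2) * (S1 - S2) = - (qpoch q ^+ 3)^-1 * V.
    by rewrite VE; field; exact: Q0.
  by apply: cvgM; [exact: cvg_cst|exact: (lhs_cvg hV)].
have sumE (f : int * int -> K) l : has_sum f l -> sum f = l.
  by move=> h; apply: (cvg_lim _ h); exact: norm_hausdorff.
split.
- by apply/cvg_ex; exists (- (q / qpoch q ^+ 2) * (S1 - S2)).
- by split => //; apply/cvg_ex; exists (qpoch q).
- by apply/cvg_ex; exists S1.
- by apply/cvg_ex; exists S2.
- rewrite (sumE _ _ hS1) (sumE _ _ hS2).
  by apply: (cvg_lim _ cvg_lhs); exact: norm_hausdorff.
Qed.

End LeftSide.

Theorem theorem6p2 (R : realType) (q : R[i]) (q_gt0 : 0 < `|q|)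
    (q_lt1 : `|q| < 1) :
  [/\ cvgn (fun N : nat => \sum_(1 <= n < N) lhs_term q n),
      cvgn (qpoch_part q) /\ qpoch q != 0,
      cvg (partial_sum (on_pairs nonneg_pair (hecke_term q)) @ totally),
      cvg (partial_sum (on_pairs neg_pair (hecke_term q)) @ totally)
    & \big[+%R/0]_(1 <= n <oo) lhs_term q n =
      - (q / qpoch q ^+ 2) *
        (sum (on_pairs nonneg_pair (hecke_term q)) -
         sum (on_pairs neg_pair (hecke_term q)))].
Proof. exact: (hecke_identity (@abs_complete_complex R) q_gt0 q_lt1). Qed.
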